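(* Let $\mathcal H=L(\Lambda;\Delta^+)$ be a unitary highest weight representation of $\mathfrak g$. (a) If $m_{\Lambda-\gamma}\ne0$ for some $\gamma\in\Gamma(\Lambda)$, then there exists a sum $\eta$ of pairwise distinct positive odd roots such that $\eta-\gamma\in Q_{\bar0}^+$. (b) Let $N=\max\{\mathrm{ht}(\eta):\eta\text{ is a sum of pairwise distinct positive odd roots}\}$. If $m_{\Lambda-\gamma}\ne0$ (with $\gamma\in\Gamma(\Lambda)$), then $\mathrm{ht}(\gamma)\le N$.
   Context: Lie superalgebra. $\mathfrak g=\mathfrak g_{\bar0}\oplus\mathfrak g_{\bar1}$ is one of the complex Lie superalgebras $\mathfrak{sl}(m|n)$ ($m,n\ge1$, $m\neq n$; for $m=n$ one works with $\mathfrak{gl}(n|n)$ instead of $\mathfrak{sl}(n|n)$), $\mathfrak{osp}(m|2n)$ ($m,n\ge1$), or the exceptional $F(4)$ ($\mathfrak g_{\bar0}=\mathfrak{so}(7)\oplus\mathfrak{sl}(2)$, $\mathfrak g_{\bar1}=$ spin $\otimes\,\mathbb C^2$). The invariant form $(X,Y)$ is $\mathrm{str}(XY)$, $\frac12\mathrm{str}(XY)$, $\frac16\mathrm{str}_{\mathfrak g}(\mathrm{ad}X\,\mathrm{ad}Y)$, respectively; it induces a form $(\cdot,\cdot)$ on $\mathfrak h^*$. With $\Omega_n=\begin{pmatrix}0&I_n\\-I_n&0\end{pmatrix}$, $\mathfrak{osp}(m|2n)$ consists of the block matrices $\begin{pmatrix}A&B\\C&D\end{pmatrix}\in\mathfrak{gl}(m|2n)$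 with $A=-A^T$, $D=\Omega_nD^T\Omega_n$, $C=-\Omega_nB^T$. Cartan subalgebra $\mathfrak h\subseteq\mathfrak g_{\bar0}$: diagonal matrices for $\mathfrak{sl},\mathfrak{gl}$, with coordinates $\epsilon_i$ (entry $i\leq m$), $\delta_a$ (entry $m+a$); for $\mathfrak{osp}(m|2n)$, $r=\lfloor m/2\rfloor$, the matrices $H=\mathrm{diag}(t_1K,\dots,t_rK,0_{m-2r},i\Omega_n\mathrm{diag}(D,D))$ with $K=\begin{pmatrix}0&i\\-i&0\end{pmatrix}$, $D=\mathrm{diag}(d_1,\dots,d_n)$, $\epsilon_i(H)=t_i$, $\delta_a(H)=d_a$; for $F(4)$ the complexification of a Cartan subalgebra of a maximal compact subalgebra of the even real form below, with $\epsilon_1,\epsilon_2,\epsilon_3$ for $\mathfrak{so}(7)$ and $\delta$ the root of $\mathfrak{sl}(2)$. Roots $\Delta=\Delta_{\bar0}\sqcup\Delta_{\bar1}$. Fixed even positive system $\Delta_{\bar0}^+$: $\{\epsilon_i-\epsilon_j,\delta_a-\delta_b:i<j,a<b\}$ for $\mathfrak{sl},\mathfrak{gl}$; $\{\delta_a\pm\delta_b\ (a<b),2\delta_a,\epsilon_i\pm\epsilon_j\ (i<j)\}$, plus $\{\epsilon_i\}$ if $m$ is odd, for $\mathfrak{osp}$; $\{\delta,\epsilon_i,\epsilon_i\pm\epsilon_j\ (i<j)\}$ for $F(4)$. A positive system $\Delta^+=\Delta_{\bar0}^+\sqcup\Delta_{\bar1}^+$ extends this, with simple system $\Pi$; $\rho=\rho_{\bar0}-\rho_{\bar1}$,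 $\rho_{\bar z}=\frac12\sum_{\alpha\in\Delta_{\bar z}^+}\alpha$; $\mathfrak n_{\bar1}^\pm=\bigoplus_{\alpha\in\Delta_{\bar1}^+}\mathfrak g^{\pm\alpha}$. $Q^+=\sum_{\alpha\in\Delta^+}\mathbb Z_{\ge0}\alpha$, $Q_{\bar0}^+=\sum_{\alpha\in\Delta_{\bar0}^+}\mathbb Z_{\ge0}\alpha$; for $\gamma=\sum_{\alpha\in\Pi}n_\alpha\alpha\in Q^+$, $\mathrm{ht}(\gamma)=\sum_{\alpha\in\Pi}n_\alpha$. The empty sum of odd roots is allowed. Real forms. $\omega$ is a conjugate-linear anti-involution of $\mathfrak g$ (parity preserving, $\omega^2=\mathrm{id}$, $\omega([X,Y])=[\omega(Y),\omega(X)]$) of one of these types: $\omega(X)=J^{-1}\overline X^{\,t}J$ with $J=\mathrm{diag}(I_p,-I_q,\pm I_n)$, $p+q=m$, for $\mathfrak{sl},\mathfrak{gl}$; $J=\mathrm{diag}(\pm I_m,i\Omega_n)$ for $\mathfrak{osp}(m|2n)$, or, if $m=2r$, $J=\mathrm{diag}(i\bigoplus_{i=1}^r\Omega_1,\pm I_{2n})$; for $F(4)$, an anti-involution defining a real form with even part $\mathfrak{so}(7)\oplus\mathfrak{sl}(2,\mathbb R)$ or $\mathfrak{so}(2,5)\oplus\mathfrak{su}(2)$. The even real form is $\mathfrak g_{\bar0,\mathbb R}=\{X\in\mathfrak g_{\bar0}:\omega(X)=-X\}$. Standing assumption: $\Delta^+$ is $\omega$-adapted with sign $\varepsilon\in\{\pm1\}$,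 i.e. there are bases $\{\partial_i\}$ of $\mathfrak n_{\bar1}^+$ and $\{x_i\}$ of $\mathfrak n_{\bar1}^-$ with $(\partial_i,x_j)=\delta_{ij}$ and $\omega(x_i)=\varepsilon\partial_i$ for all $i,j$. A $\mathfrak g$-representation $\mathcal H$ is unitary if it carries a positive definite Hermitian form with $\langle\mathcal H_{\bar0},\mathcal H_{\bar1}\rangle=0$ and $\langle Xv,w\rangle=\langle v,\omega(X)w\rangle$; similarly for $\mathfrak g_{\bar0}$-modules. Branching data. $L(\Lambda;\Delta^+)$ is the simple highest weight $\mathfrak g$-representation of highest weight $\Lambda$; $L_0(\mu)$ the simple highest weight $\mathfrak g_{\bar0}$-module with respect to $\Delta_{\bar0}^+$; $m_\mu$ is the multiplicity of $L_0(\mu)$ in the (completely reducible) restriction $\mathcal H|_{\mathfrak g_{\bar0}}$. Let $\mathfrak k$ be a maximal compact subalgebra of $\mathfrak g_{\bar0,\mathbb R}$ with $\mathfrak h\subseteq\mathfrak k^{\mathbb C}$ and $\Delta^+_{\bar0,nc}$ the positive even roots $\beta$ with $\mathfrak g^\beta\not\subseteq\mathfrak k^{\mathbb C}$. $\Gamma$ is the set of all weights $\sum_{\alpha\in S}\alpha+\sum_{\beta\in\Delta_{\bar0,nc}^+}n_\beta\beta$ with $S\subseteq\Delta_{\bar1}^+$, $n_\beta\in\mathbb Z_{\ge0}$; for $\mathfrak{sl}(m|n)$, $\mathfrak{gl}(m|n)$ one takes all $n_\beta=0$. $\Gamma(\Lambda)$ is the set of $\gamma\in\Gamma$ such that $L_0(\Lambda-\gamma)$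 is unitary and, if $\gamma\ne0$, $-\varepsilon\big((\Lambda-\gamma+2\rho,\Lambda-\gamma)-(\Lambda+2\rho,\Lambda)\big)>0$. *)

(* Defs.v *)
From HB Require Import structures.
From mathcomp Require Import all_boot all_order all_algebra.
From mathcomp Require Import mathcomp_extra boolp classical_sets functions.
From mathcomp Require Import cardinality fsbigop.
From mathcomp Require Import reals constructive_ereal ereal.
From mathcomp Require Import complex.

Set Implicit Arguments.
Unset Strict Implicit.
Unset Printing Implicit Defensive.
Import Order.TTheory GRing.Theory Num.Theory.

Local Open Scope classical_set_scope.
Local Open Scope ring_scope.

(** Conventions: the complex numbers are [complex R] with [R] a [realType];
    in [complex R] the relation [0 < z] means that [z] is real and positive.
    Parities are booleans, [false] being even and [true] odd. *)

(** ** Lie superalgebras and their representations *)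

Record lieSuper (R : realType) := LieSuper {
  carrier :> vectType (complex R);
  gpart : bool -> {vspace carrier};
  br : carrier -> carrier -> carrier;
  gpart_sum : (gpart false + gpart true = fullv)%VS;
  gpart_cap : (gpart false :&: gpart true = 0)%VS;
  br_linearl : forall y, linear (br^~ y);
  br_linearr : forall x, linear (br x);
  br_parity : forall a b x y, x \in gpart a -> y \in gpart b ->
    br x y \in gpart (a (+) b);
  br_skew : forall a b x y, x \in gpart a -> y \in gpart b ->
    br x y = - ((-1) ^+ (a && b) *: br y x);
  br_jacobi : forall a b x y z, x \in gpart a -> y \in gpart b ->
    br x (br y z) = br (br x y) z + (-1) ^+ (a && b) *: br y (br x z)
}.

Definition subspace (K : pzRingType) (V : lmodType K) (W : set V) : Prop :=
  W 0 /\ forall c u v, W u -> W v -> W (c *: u + v).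

Record superrep (R : realType) (g : lieSuper R) := SuperRep {
  srep_sort :> lmodType (complex R);
  hpart : bool -> set srep_sort;
  sact : g -> srep_sort -> srep_sort;
  hpart_sub : forall a, subspace (hpart a);
  hpart_sum : forall v, exists v0 v1,
    [/\ hpart false v0, hpart true v1 & v = v0 + v1];
  hpart_cap : forall v, hpart false v -> hpart true v -> v = 0;
  sact_linearl : forall v, linear (sact^~ v);
  sact_linearr : forall X, linear (sact X);
  sact_parity : forall a b X v, X \in gpart g a -> hpart b v ->
    hpart (a (+) b) (sact X v);
  sact_br : forall a b X Y v, X \in gpart g a -> Y \in gpart g b ->
    sact (br X Y) v =
      sact X (sact Y v) - (-1) ^+ (a && b) *: sact Y (sact X v)
}.

(** Representations of the even part: only the values [eact X] with [X] even
    are meaningful. *)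
Record evenrep (R : realType) (g : lieSuper R) := EvenRep {
  erep_sort :> lmodType (complex R);
  eact : g -> erep_sort -> erep_sort;
  eact_linearl : forall c X Y v, X \in gpart g false -> Y \in gpart g false ->
    eact (c *: X + Y) v = c *: eact X v + eact Y v;
  eact_linearr : forall X, X \in gpart g false -> linear (eact X);
  eact_br : forall X Y v, X \in gpart g false -> Y \in gpart g false ->
    eact (br X Y) v = eact X (eact Y v) - eact Y (eact X v)
}.

Lemma even_restr_br (R : realType) (g : lieSuper R) (H : superrep g) X Y
    (v : H) : X \in gpart g false -> Y \in gpart g false ->
  sact (br X Y) v = sact X (sact Y v) - sact Y (sact X v).
Proof. by move=> hX hY; rewrite (sact_br v hX hY) /= expr0 scale1r. Qed.

Definition even_restr (R : realType) (g : lieSuper R) (H : superrep g) :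
    evenrep g :=
  @EvenRep R g H (@sact R g H) (fun c X Y v _ _ => @sact_linearl R g H v c X Y)
    (fun X _ => @sact_linearr R g H X) (@even_restr_br R g H).

(** ** Lie superalgebras with a Cartan subalgebra, a form, an even positive
    system and an anti-involution *)

Definition dual (R : realType) (g : lieSuper R) (h : {vspace g}) :=
  'Hom(subvs_of h, (complex R)^o).

(** [typeA] records whether the superalgebra is of type [sl] or [gl]. *)
Record superdatum (R : realType) := SuperDatum {
  alg :> lieSuper R;
  cartan : {vspace alg};
  iform : alg -> alg -> complex R;
  pos0 : set (dual cartan);
  omega : alg -> alg;
  typeA : bool
}.

Arguments pos0 {R} s.
Arguments omega {R} s.
Arguments iform {R} s.

Notation wt S := (dual (cartan S)).
Notation csa S := (subvs_of (cartan S)).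

Section Matrices.
Variable R : realType.
Local Notation C := (complex R).

Definition ctr p q (X : 'M[C]_(p, q)) : 'M[C]_(q, p) :=
  map_mx (fun z : C => Num.conj z) X^T.

(** The signature matrix diag(I_p, -I_(n-p)). *)
Definition sigmx n p : 'M[C]_n := diag_mx (\row_(i < n) (-1) ^+ (p <= i)%N).

Definition Omega n : 'M[C]_(n + n) := block_mx 0 1%:M (- 1%:M) 0.

(** E_(2i,2i+1) - E_(2i+1,2i), with rows and columns numbered from 0. *)
Definition rot m i : 'M[C]_m := \matrix_(p, q)
  (((p == i.*2 :> nat) && (q == i.*2.+1 :> nat))%:R
   - ((p == i.*2.+1 :> nat) && (q == i.*2 :> nat))%:R).

Definition supertr m n (X : 'M[C]_(m + n)) : C :=
  \tr (ulsubmx X) - \tr (drsubmx X).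

Definition mxpart m n (a : bool) : set 'M[C]_(m + n) :=
  if a then [set X | ulsubmx X = 0 /\ drsubmx X = 0]
  else [set X | ursubmx X = 0 /\ dlsubmx X = 0].

Definition slmx m n : set 'M[C]_(m + n) := [set X | supertr X = 0].

Definition ospmx m n : set 'M[C]_(m + (n + n)) := [set X |
  [/\ ulsubmx X = - (ulsubmx X)^T,
      drsubmx X = Omega n *m (drsubmx X)^T *m Omega n
    & dlsubmx X = - (Omega n *m (ursubmx X)^T)]].

(** diag(t_1 K, ..., t_r K, 0) in so(m), where r = floor(m/2) and
    K = ((0, i), (-i, 0)). *)
Definition so_cartan m (t : 'rV[C]_(m./2)) : 'M[C]_m :=
  \sum_(i < m./2) t 0 i *: ('i *: rot m i).

Definition osp_cartan m n (t : 'rV[C]_(m./2)) (d : 'rV[C]_n) :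
    'M[C]_(m + (n + n)) :=
  block_mx (so_cartan t) 0 0
    ('i *: (Omega n *m block_mx (diag_mx d) 0 0 (diag_mx d))).

(** [iota] identifies [g] with the Lie superalgebra of matrices [P], with the
    supercommutator as bracket. *)
Definition mx_identification m n (g : lieSuper R) (P : set 'M[C]_(m + n))
    (iota : {linear g -> 'M[C]_(m + n)}) : Prop :=
  [/\ injective iota,
      forall Z, P Z <-> exists X, iota X = Z,
      forall a X, X \in gpart g a <-> mxpart a (iota X)
    & forall a b X Y, X \in gpart g a -> Y \in gpart g b ->
        iota (br X Y) =
          iota X *m iota Y - (-1) ^+ (a && b) *: (iota Y *m iota X)].

(** The even positive systems, as linear functions of the coordinates
    (t, d) = (epsilon_i, delta_a) on the Cartan subalgebra. *)
Definition posA m n : set ('rV[C]_m -> 'rV[C]_n -> C) :=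
  [set f : 'rV[C]_m -> 'rV[C]_n -> C |
  (exists i j : 'I_m, (i < j)%N /\ f = fun t d => t 0 i - t 0 j) \/
  (exists a b : 'I_n, (a < b)%N /\ f = fun t d => d 0 a - d 0 b)].

Definition posB r n (shorteps : bool) : set ('rV[C]_r -> 'rV[C]_n -> C) :=
  [set f : 'rV[C]_r -> 'rV[C]_n -> C |
    (exists a b : 'I_n, (a < b)%N /\
       (f = (fun t d => d 0 a - d 0 b) \/ f = (fun t d => d 0 a + d 0 b))) \/
    (exists a, f = fun t d => 2 * d 0 a) \/
    (exists i j : 'I_r, (i < j)%N /\
       (f = (fun t d => t 0 i - t 0 j) \/ f = (fun t d => t 0 i + t 0 j))) \/
    (shorteps /\ exists i, f = fun t d => t 0 i)].

Definition posF : set ('rV[C]_3 -> 'rV[C]_1 -> C) :=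
  [set f : 'rV[C]_3 -> 'rV[C]_1 -> C |
    (f = fun t d => d 0 0) \/
    (exists i, f = fun t d => t 0 i) \/
    (exists i j : 'I_3, (i < j)%N /\
       (f = (fun t d => t 0 i - t 0 j) \/ f = (fun t d => t 0 i + t 0 j)))].

(** Transport of a set of linear functions of the coordinates to weights;
    [co H t d] says that (t, d) are the coordinates of [H]. *)
Definition wt_of r s (g : lieSuper R) (h : {vspace g})
    (co : g -> 'rV[C]_r -> 'rV[C]_s -> Prop)
    (F : set ('rV[C]_r -> 'rV[C]_s -> C)) : set (dual h) :=
  [set a | exists f, F f /\
    forall (H : subvs_of h) t d, co (vsval H) t d -> a H = f t d].

(** ** Anti-involutions and compact subalgebras *)

Definition anti_involution (g : lieSuper R) (om : g -> g) : Prop :=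
  [/\ forall c X Y, om (c *: X + Y) = Num.conj c *: om X + om Y,
      forall a X, X \in gpart g a -> om X \in gpart g a,
      involutive om
    & forall X Y, om (br X Y) = br (om Y) (om X)].

Definition even_real_form (g : lieSuper R) (om : g -> g) : set g :=
  [set X | X \in gpart g false /\ om X = - X].

Definition real_subalgebra (g : lieSuper R) (k : set g) : Prop :=
  [/\ k 0, forall c X Y, c \is Num.real -> k X -> k Y -> k (c *: X + Y)
    & forall X Y, k X -> k Y -> k (br X Y)].

(** [k] is a compact subalgebra of the real Lie algebra [g0]: the closure of
    the group generated by exp(ad k) is compact, i.e. ad k is skew-symmetric
    for some inner product on [g0]. *)
Definition compact_subalgebra (g : lieSuper R) (g0 k : set g) : Prop :=
  [/\ real_subalgebra k, k `<=` g0 &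
    exists b : g -> g -> C,
      [/\ forall X Y, g0 X -> g0 Y -> b X Y \is Num.real /\ b X Y = b Y X,
          forall c X Y Z, c \is Num.real -> g0 X -> g0 Y -> g0 Z ->
            b (c *: X + Y) Z = c * b X Z + b Y Z,
          forall X, g0 X -> X != 0 -> 0 < b X X
        & forall U X Y, k U -> g0 X -> g0 Y ->
            b (br U X) Y = - b X (br U Y)]].

Definition maximal_compact (g : lieSuper R) (g0 k : set g) : Prop :=
  compact_subalgebra g0 k /\
  forall k', compact_subalgebra g0 k' -> k `<=` k' -> k' = k.

Definition complexification (g : lieSuper R) (k : set g) : set g :=
  [set X | exists Y Z, [/\ k Y, k Z & X = Y + 'i *: Z]].

(** ** The families sl(m|n), gl(n|n), osp(m|2n) *)

Definition typeA_omega m n (g : lieSuper R)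
    (iota : {linear g -> 'M[C]_(m + n)}) (om : g -> g) : Prop :=
  exists (p : nat) (s : bool), (p <= m)%N /\
    let J : 'M[C]_(m + n) := block_mx (sigmx m p) 0 0 ((-1) ^+ s)%:M in
    forall X, iota (om X) = invmx J *m ctr (iota X) *m J.

Definition typeA_datum m n (P : set 'M[C]_(m + n)) (S : superdatum R) : Prop :=
  exists iota : {linear S -> 'M[C]_(m + n)},
  [/\ mx_identification P iota,
      forall X, X \in cartan S <-> is_diag_mx (iota X),
      forall X Y, iform S X Y = supertr (iota X *m iota Y),
      pos0 S = wt_of (fun X t d => iota X = diag_mx (row_mx t d)) (@posA m n)
    & typeA_omega iota (omega S) /\ typeA S].

Definition sl_datum (S : superdatum R) : Prop :=
  exists m n, [/\ (0 < m)%N, (0 < n)%N, m != n & typeA_datum (@slmx m n) S].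

Definition gl_datum (S : superdatum R) : Prop :=
  exists n, (0 < n)%N /\ typeA_datum [set: 'M[C]_(n + n)] S.

Definition osp_omega m n (g : lieSuper R)
    (iota : {linear g -> 'M[C]_(m + (n + n))}) (om : g -> g) : Prop :=
  exists s : bool,
    let J1 : 'M[C]_(m + (n + n)) :=
      block_mx ((-1) ^+ s)%:M 0 0 ('i *: Omega n) in
    let J2 : 'M[C]_(m + (n + n)) :=
      block_mx ('i *: \sum_(i < m./2) rot m i) 0 0 ((-1) ^+ s)%:M in
    (forall X, iota (om X) = invmx J1 *m ctr (iota X) *m J1) \/
    (~~ odd m /\ forall X, iota (om X) = invmx J2 *m ctr (iota X) *m J2).

Definition osp_datum (S : superdatum R) : Prop :=
  exists m n, [/\ (0 < m)%N, (0 < n)%N &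
  exists iota : {linear S -> 'M[C]_(m + (n + n))},
  [/\ mx_identification (@ospmx m n) iota,
      forall X, X \in cartan S <-> exists t d, iota X = osp_cartan t d,
      forall X Y, iform S X Y = 2^-1 * supertr (iota X *m iota Y),
      pos0 S = wt_of (fun X t d => iota X = osp_cartan t d)
                 (@posB m./2 n (odd m))
    & osp_omega iota (omega S) /\ ~~ typeA S]].

(** ** The exceptional superalgebra F(4) *)

Definition supertrace (g : lieSuper R) (f : g -> g) : C :=
  let b := vbasis {:g} in
  \sum_(i < \dim {:g}) coord b i
    (daddv_pi (gpart g false) (gpart g true) (f b`_i)
     - daddv_pi (gpart g true) (gpart g false) (f b`_i)).

Definition simple_superalgebra (g : lieSuper R) : Prop :=
  (exists X Y : g, br X Y != 0) /\
  forall I : {vspace g},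
    (I = (I :&: gpart g false) + (I :&: gpart g true))%VS ->
    (forall X Y, Y \in I -> br X Y \in I) -> I = 0%VS \/ I = fullv.

(** The 8-dimensional Clifford modules are, up to isomorphism, two; both
    restrict to the spin representation of so(7). *)
Definition clifford7 (gam : 'I_7 -> 'M[C]_8) : Prop :=
  forall i j, gam i *m gam j + gam j *m gam i = ((i == j)%:R *+ 2)%:M.

(** The skew matrix E_ij - E_ji acts on spinors by gam_i gam_j / 2. *)
Definition spin (gam : 'I_7 -> 'M[C]_8) (A : 'M[C]_7) : 'M[C]_8 :=
  4^-1 *: \sum_i \sum_j A i j *: (gam i *m gam j).

Definition F4_even : set ('M[C]_7 * 'M[C]_2) :=
  [set x | x.1 = - x.1^T /\ \tr x.2 = 0].

Definition pair_br (x y : 'M[C]_7 * 'M[C]_2) : 'M[C]_7 * 'M[C]_2 :=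
  (x.1 *m y.1 - y.1 *m x.1, x.2 *m y.2 - y.2 *m x.2).

(** F(4) is the simple Lie superalgebra with even part so(7) + sl(2), embedded
    by [phi] (whose values off [F4_even] are irrelevant), and odd part
    spin (x) C^2, whose elements are written as 8 x 2 matrices. *)
Definition F4_identification (g : lieSuper R) (gam : 'I_7 -> 'M[C]_8)
    (phi : {linear ('M[C]_7 * 'M[C]_2)%type -> g})
    (psi : {linear 'M[C]_(8, 2) -> g}) : Prop :=
  [/\ simple_superalgebra g /\ clifford7 gam,
      set_bij F4_even [set X | X \in gpart g false] phi,
      set_bij setT [set X | X \in gpart g true] psi,
      forall x y, F4_even x -> F4_even y ->
        phi (pair_br x y) = br (phi x) (phi y)
    & forall x Z, F4_even x ->
        br (phi x) (psi Z) = psi (spin gam x.1 *m Z + Z *m x.2^T)].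

(** The coordinate d is the value of the root of sl(2) at
    diag(d/2, -d/2). *)
Definition F4_cartan (t : 'rV[C]_3) (d : 'rV[C]_1) : 'M[C]_7 * 'M[C]_2 :=
  (so_cartan (m := 7) t,
   diag_mx (\row_(i < 2) ((-1) ^+ i * (d 0 0 / 2)))).

Definition so_real p : set 'M[C]_7 := [set A : 'M[C]_7 |
  (forall i j, A i j \is Num.real) /\ A^T *m sigmx 7 p + sigmx 7 p *m A = 0].

Definition sl2_real : set 'M[C]_2 := [set A : 'M[C]_2 |
  (forall i j, A i j \is Num.real) /\ \tr A = 0].

Definition su2 : set 'M[C]_2 :=
  [set A : 'M[C]_2 | ctr A = - A /\ \tr A = 0].

Definition real_isomorphic (D : set ('M[C]_7 * 'M[C]_2)) (g : lieSuper R)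
    (g0 : set g) : Prop :=
  exists f : 'M[C]_7 * 'M[C]_2 -> g,
  [/\ set_bij D g0 f,
      forall c x y, c \is Num.real -> D x -> D y ->
        f (c *: x + y) = c *: f x + f y
    & forall x y, D x -> D y -> f (pair_br x y) = br (f x) (f y)].

Definition F4_omega (g : lieSuper R) (h : {vspace g}) (om : g -> g) : Prop :=
  let g0 := even_real_form om in
  (real_isomorphic [set x | so_real 7 x.1 /\ sl2_real x.2] g0 \/
   real_isomorphic [set x | so_real 2 x.1 /\ su2 x.2] g0) /\
  exists k, maximal_compact g0 k /\
    [set X | X \in h] = complexification [set X | X \in h /\ k X].

Definition F4_datum (S : superdatum R) : Prop :=
  exists gam (phi : {linear ('M[C]_7 * 'M[C]_2)%type -> S}) psi,
  [/\ F4_identification gam phi psi,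
      forall X, X \in cartan S <-> exists t d, X = phi (F4_cartan t d),
      forall X Y : S,
        iform S X Y = 6^-1 * supertrace (fun Z => br X (br Y Z)),
      pos0 S = wt_of (fun X t d => X = phi (F4_cartan t d)) posF
    & F4_omega (cartan S) (omega S) /\ ~~ typeA S].

Definition standard (S : superdatum R) : Prop :=
  anti_involution (omega S) /\
  (sl_datum S \/ gl_datum S \/ osp_datum S \/ F4_datum S).

End Matrices.

Section Theory.
Variables (R : realType) (S : superdatum R).
Local Notation C := (complex R).

(** ** Roots, positive systems *)

Definition rootsp (a : wt S) : set S :=
  [set X | forall H : csa S, br (vsval H) X = (a H : C) *: X].

Definition roots_of (z : bool) : set (wt S) :=
  [set a | a != 0 /\ exists X, [/\ X != 0, X \in gpart S z & rootsp a X]].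

Definition roots : set (wt S) := roots_of false `|` roots_of true.

(** The choice of an element of the Cartan subalgebra on which all roots take
    real nonzero values determines a positive system. *)
Definition positive_system (P : set (wt S)) : Prop :=
  (exists H0 : csa S,
     (forall a, roots a -> 0 < (a H0 : C) \/ (a H0 : C) < 0) /\
     P = [set a | roots a /\ 0 < (a H0 : C)]) /\
  P `&` roots_of false = pos0 S.

Section PositiveSystem.
Variable P : set (wt S).

Definition pos1 : set (wt S) := P `&` roots_of true.

Definition simple_roots : set (wt S) :=
  [set a | P a /\ ~ exists b c, [/\ P b, P c & a = b + c]].

(** The sums of lists of elements of [A], i.e. the nonnegative integral
    combinations of elements of [A]. *)
Definition cone (A : set (wt S)) : set (wt S) :=
  [set g | exists2 s : seq (wt S), (forall a, a \in s -> A a) &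
     g = \sum_(a <- s) a].

Definition distinct_sums (A : set (wt S)) : set (wt S) :=
  [set g | exists2 s : seq (wt S), uniq s /\ (forall a, a \in s -> A a) &
     g = \sum_(a <- s) a].

(** A list of [k] simple roots encodes a combination of simple roots whose
    coefficients have sum [k]; the simple roots being linearly independent,
    [k] is unique. *)
Definition ht (g : wt S) : nat :=
  xget 0%N [set k | exists s : seq (wt S),
    [/\ forall a, a \in s -> simple_roots a, g = \sum_(a <- s) a
      & size s = k]].

Definition is_max_ht (N : nat) : Prop :=
  (exists2 eta, distinct_sums pos1 eta & ht eta = N) /\
  (forall eta, distinct_sums pos1 eta -> (ht eta <= N)%N).

Definition rho : wt S :=
  (2^-1 : C) *: (\sum_(a \in pos0 S) a - \sum_(a \in pos1) a).

(** [nil1 false] and [nil1 true] are the sums of the root spaces of the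
    positive odd roots and of their opposites. *)
Definition nil1 (s : bool) : set S :=
  [set X | exists (l : seq (wt S)) (F : wt S -> S),
     (forall a, a \in l -> pos1 a /\ rootsp ((-1 : C) ^+ s *: a) (F a)) /\
     X = \sum_(a <- l) F a].

Definition basis_of_set (d : nat) (b : d.-tuple S) (W : set S) : Prop :=
  free b /\ forall X, X \in <<b>>%VS <-> W X.

Definition adapted (e : C) : Prop :=
  (e = 1 \/ e = -1) /\
  exists (d : nat) (p x : d.-tuple S),
  [/\ basis_of_set p (nil1 false), basis_of_set x (nil1 true),
      forall i j, iform S (tnth p i) (tnth x j) = (i == j)%:R
    & forall i, omega S (tnth x i) = e *: tnth p i].

(** ** Modules *)

Definition hw_vector (H : superrep S) (L : wt S) (v : H) : Prop :=
  [/\ v != 0,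
      forall T : csa S, sact (vsval T) v = (L T : C) *: v
    & forall a X, P a -> rootsp a X -> sact X v = 0].

Definition graded_submodule (H : superrep S) (W : set H) : Prop :=
  [/\ subspace W, forall X v, W v -> W (sact X v)
    & forall v0 v1, hpart false v0 -> hpart true v1 -> W (v0 + v1) ->
        W v0 /\ W v1].

(** [H] is the simple highest weight representation of highest weight [L]. *)
Definition is_simple_hw (H : superrep S) (L : wt S) : Prop :=
  (exists (a : bool) (v : H), hpart a v /\ hw_vector L v) /\
  forall W : set H, graded_submodule W -> W = [set 0] \/ W = setT.

End PositiveSystem.

Definition even_submodule (M : evenrep S) (W : set M) : Prop :=
  subspace W /\ forall X v, X \in gpart S false -> W v -> W (eact X v).

(** The submodule [W] is isomorphic to the simple even module of highest
    weight [mu]. *)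
Definition is_L0 (M : evenrep S) (W : set M) (mu : wt S) : Prop :=
  [/\ even_submodule W,
      forall W', even_submodule W' -> W' `<=` W -> W' = [set 0] \/ W' = W
    & exists v : M,
      [/\ W v, v != 0,
          forall T : csa S, vsval T \in gpart S false ->
            eact (vsval T) v = (mu T : C) *: v
        & forall a X, pos0 S a -> X \in gpart S false -> rootsp a X ->
            eact X v = 0]].

(** The multiplicity of the simple module of highest weight [mu] in [M]: the
    largest number of copies of it (possibly infinite) in a direct sum inside
    [M]; for completely reducible [M] this is the number of summands isomorphic
    to it in a decomposition into simple modules. *)
Definition mult (M : evenrep S) (mu : wt S) : \bar R :=
  ereal_sup [set (k%:R)%:E | k in [set k : nat |
    exists W : 'I_k -> set M, (forall i, is_L0 (W i) mu) /\
      forall u : 'I_k -> M, (forall i, W i (u i)) ->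
        \sum_i u i = 0 -> forall i, u i = 0]].

Definition hermitian_pos (V : lmodType C) (f : V -> V -> C) : Prop :=
  [/\ forall c u v w, f (c *: u + v) w = c * f u w + f v w,
      forall u v, f v u = Num.conj (f u v)
    & forall v, v != 0 -> 0 < f v v].

Definition unitary (H : superrep S) : Prop :=
  exists f : H -> H -> C,
  [/\ hermitian_pos f,
      forall v w, hpart false v -> hpart true w -> f v w = 0
    & forall X v w, f (sact X v) w = f v (sact (omega S X) w)].

Definition even_unitary (M : evenrep S) : Prop :=
  exists f : M -> M -> C, hermitian_pos f /\
    forall X v w, X \in gpart S false ->
      f (eact X v) w = f v (eact (omega S X) w).

Definition L0_unitary (mu : wt S) : Prop :=
  exists M : evenrep S, is_L0 [set: M] mu /\ even_unitary M.

(** ** Branching data *)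

Definition dualvec (a : wt S) : csa S :=
  xget 0 [set T | forall H : csa S, iform S (vsval T) (vsval H) = a H].

Definition wform (a b : wt S) : C :=
  iform S (vsval (dualvec a)) (vsval (dualvec b)).

Definition noncompact_pos (k : set S) : set (wt S) :=
  [set b | pos0 S b /\ ~ rootsp b `<=` complexification k].

Definition Gam (P : set (wt S)) (k : set S) : set (wt S) :=
  [set g | exists g1 g0, [/\ distinct_sums (pos1 P) g1,
     (if typeA S then g0 = 0 else cone (noncompact_pos k) g0)
   & g = g1 + g0]].

Definition GamL (P : set (wt S)) (k : set S) (e : C) (L : wt S) :
    set (wt S) :=
  [set g | [/\ Gam P k g, L0_unitary (L - g) &
     g != 0 ->
     0 < - e * (wform (L - g + rho P *+ 2) (L - g)
                - wform (L + rho P *+ 2) L)]].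

End Theory.

(* Main.v *)
Require Import Defs.
From HB Require Import structures.
From mathcomp Require Import all_boot all_order all_algebra.
From mathcomp Require Import boolp classical_sets.
From mathcomp Require Import reals constructive_ereal ereal.
From mathcomp Require Import complex ring zify.
Import Order.TTheory GRing.Theory Num.Theory.
Local Open Scope classical_set_scope.
Local Open Scope ring_scope.

Set Implicit Arguments.
Unset Strict Implicit.
Unset Printing Implicit Defensive.

(** Let [w] be a highest weight vector for the even part, of weight
    [Lam - gam]. By unitarity [w] is orthogonal to [X u] for every [u] and every
    negative even root vector [X], since the adjoint of [X] is a positive even
    root vector. The representation is spanned by words in negative root vectors
    applied to the highest weight vector. Modulo shorter words the letters of a
    word may be permuted up to sign; an even letter can be moved to the front,
    and a repeated odd letter makes the word equal to a shorter one. So [w],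
    which is not orthogonal to everything, pairs nontrivially with some word in
    pairwise distinct odd letters. As different weights are orthogonal, [gam] is
    the sum of the corresponding odd roots: in (a) one can take [eta = gam], and
    (b) follows. *)

(** The conjugate-linear [omega] exchanges the root spaces of [a] and [- a] only when [a] is real
    for it. Positive definiteness supplies this: the weight of a nonzero vector is real, so a root
    vector that does not kill some weight vector has a real weight. This is why the arguments below
    always split off the case of a vanishing product. Shortening a repeated odd letter rests on X^2
    = [X, X]/2, which handles two letters of equal weight because odd root spaces are lines. That
    fact, the weight decomposition of each parity, the stability of the Cartan subalgebra under
    [omega] and its containing all vectors of weight zero are checked for each family in coordinates
    where the Cartan subalgebra acts diagonally. The delicate point is F(4), where the weights of
    the spin representation must be shown to be simple. *)

HB.instance Definition _ (R : realType) (g : lieSuper R) (x : g) :=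
  GRing.isLinear.Build _ _ _ _ (br x) (br_linearr x).

HB.instance Definition _ (R : realType) (g : lieSuper R) (H : superrep g)
    (x : g) :=
  GRing.isLinear.Build _ _ _ _ (@sact R g H x) (@sact_linearr R g H x).

(** * Rules for the bracket, the action and the grading *)

Section Superalgebra.
Variables (R : realType) (g : lieSuper R).
Local Notation C := (complex R).
Implicit Types (X Y Z : g).

Lemma brDl X Y Z : br (X + Y) Z = br X Z + br Y Z.
Proof. by have := br_linearl Z 1 X Y; rewrite !scale1r. Qed.

Lemma br0l Z : br 0 Z = 0.
Proof. by apply: (addrI (br 0 Z)); rewrite -brDl !addr0. Qed.

Lemma brZl (c : C) X Z : br (c *: X) Z = c *: br X Z.
Proof. by have := br_linearl Z c X 0; rewrite br0l !addr0. Qed.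

Lemma sactDl (H : superrep g) X Y (u : H) : sact (X + Y) u = sact X u + sact Y u.
Proof. by have := sact_linearl u 1 X Y; rewrite !scale1r. Qed.

Lemma sact0l (H : superrep g) (u : H) : sact 0 u = 0.
Proof. by apply: (addrI (sact 0 u)); rewrite -sactDl !addr0. Qed.

Lemma sactZl (H : superrep g) (c : C) X (u : H) : sact (c *: X) u = c *: sact X u.
Proof. by have := sact_linearl u c X 0; rewrite sact0l !addr0. Qed.

Lemma br_even_skew z X Y : X \in gpart g false -> Y \in gpart g z ->
  br X Y = - br Y X.
Proof. by move=> hX hY; rewrite (br_skew hX hY) expr0 scale1r. Qed.

Lemma gpart_decomp X : exists X0 X1,
  [/\ X0 \in gpart g false, X1 \in gpart g true & X = X0 + X1].
Proof.
have : X \in (gpart g false + gpart g true)%VS by rewrite gpart_sum memvf.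
by case/memv_addP => X0 h0 [X1 h1 ->]; exists X0, X1.
Qed.

Lemma hpart0 (H : superrep g) z : hpart z (0 : H).
Proof. by case: (hpart_sub H z). Qed.

End Superalgebra.

Lemma subspace_closed (K : pzRingType) (V : lmodType K) (W : set V) :
  Defs.subspace W -> [/\ W 0, forall u v, W u -> W v -> W (u + v)
                  & forall c u, W u -> W (c *: u)].
Proof.
case=> W0 hW; split=> // [u v Wu Wv|c u Wu].
- by have := hW 1 u v Wu Wv; rewrite scale1r.
- by have := hW c u 0 Wu W0; rewrite addr0.
Qed.

(** Everything that the argument uses about the families [sl], [gl], [osp] and
    [F(4)]. *)
Record regular_cartan (R : realType) (S : superdatum R) : Prop := RegularCartan {
  cartan_even : forall T : S, T \in cartan S -> T \in gpart S false;
  cartan_omega : forall T : S, T \in cartan S -> omega S T \in cartan S;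
  weight_decomp : forall z (X : S), X \in gpart S z ->
    exists2 l : seq S, X = \sum_(Y <- l) Y &
      forall Y, Y \in l -> Y \in gpart S z /\ exists a, rootsp a Y;
  zero_rootsp : forall z (X : S), X \in gpart S z -> rootsp 0 X ->
    X \in cartan S;
  odd_rootsp_line : forall a (X Y : S), X \in gpart S true ->
    Y \in gpart S true -> rootsp a X -> rootsp a Y -> Y != 0 ->
    exists c, X = c *: Y
}.

(** * Spanning words and singular vectors *)

Section Words.
Variables (R : realType) (S : superdatum R).
Local Notation C := (complex R).
Hypothesis hS : regular_cartan S.
Hypothesis hom : anti_involution (omega S).
Variables (P : set (wt S)) (H0 : csa S).
Hypothesis hH0 : forall a, Defs.roots a -> 0 < (a H0 : C) \/ (a H0 : C) < 0.
Hypothesis hP : P = [set a | Defs.roots a /\ 0 < (a H0 : C)].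
Hypothesis hP0 : P `&` roots_of false = pos0 S.
Variables (Lam : wt S) (H : superrep S) (zv : bool) (v : H).
Hypothesis hv : hpart zv v.
Hypothesis hwv : hw_vector P Lam v.
Hypothesis hsimple : forall W : set H, graded_submodule W ->
  W = [set 0] \/ W = setT.
Variable f : H -> H -> C.
Hypothesis hf : hermitian_pos f.
Hypothesis hfo : forall X v w, f (sact X v) w = f v (sact (omega S X) w).

Implicit Types (X Y Z : S) (T : csa S) (u w : H) (a b : wt S).

Definition has_weight a u := forall T, sact (vsval T) u = (a T : C) *: u.

Lemma csa_even T : vsval T \in gpart S false.
Proof. exact/(cartan_even hS)/subvsP. Qed.

Lemma rootsp_br y z a b X Y : X \in gpart S y -> Y \in gpart S z ->
  rootsp a X -> rootsp b Y -> rootsp (a + b) (br X Y).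
Proof.
move=> hX hY ha hb T.
rewrite (br_jacobi _ (csa_even T) hX) /= scale1r ha hb brZl linearZ /=.
by rewrite -scalerDl add_lfunE.
Qed.

Lemma has_weight_sact z a b X u : X \in gpart S z -> rootsp a X ->
  has_weight b u -> has_weight (b + a) (sact X u).
Proof.
move=> hX ha hb T; have := sact_br u (csa_even T) hX.
rewrite /= scale1r ha hb sactZl linearZ /= => /eqP.
rewrite eq_sym subr_eq => /eqP ->.
by rewrite -scalerDl add_lfunE addrC.
Qed.

Definition omegaT T : csa S := vsproj (cartan S) (omega S (vsval T)).

Lemma vsval_omegaT T : vsval (omegaT T) = omega S (vsval T).
Proof. by rewrite vsprojK // (cartan_omega hS) // subvsP. Qed.

Lemma omegaTK : involutive omegaT.
Proof.
case: hom => _ _ omK _ T; apply: val_inj => /=.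
by rewrite !vsval_omegaT omK.
Qed.

Lemma omega0 : omega S 0 = 0.
Proof.
case: hom => omL _ _ _; apply: (addrI (omega S 0)).
by have := omL 1 0 0; rewrite conjC1 !scale1r !addr0.
Qed.

(** For such a weight [omega] maps the root space of [a] into that of [- a]; an arbitrary complex
    functional on the Cartan subalgebra need not have this property. *)
Definition real_weight a := forall T, (a (omegaT T) : C) = Num.conj (a T : C).

Lemma formZl c u w : f (c *: u) w = c * f u w.
Proof.
case: hf => lf _ _; have f0 : f 0 w = 0.
  by apply: (addrI (1 * f 0 w)); rewrite -lf scale1r !addr0 mul1r.
by have := lf c u 0 w; rewrite !addr0 f0 addr0.
Qed.

Lemma form0l w : f 0 w = 0.
Proof. by rewrite -(scale0r 0) formZl mul0r. Qed.

Lemma formDl u u' w : f (u + u') w = f u w + f u' w.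
Proof. by case: hf => lf _ _; have := lf 1 u u' w; rewrite scale1r mul1r. Qed.

Lemma formZr c u w : f u (c *: w) = Num.conj c * f u w.
Proof.
case: hf => _ cf _.
by rewrite (cf (c *: w) u) formZl rmorphM /= -(cf w u).
Qed.

Lemma form0r u : f u 0 = 0.
Proof. by rewrite -(scale0r 0) formZr conjC0 mul0r. Qed.

(** Up to conjugation, moving [T] across the form computes [f u u] times each side, and [f u u] is
    positive. *)
Lemma weight_real a u : has_weight a u -> u != 0 -> real_weight a.
Proof.
case: hf => _ _ pf hu u0 T; have /(congr1 (f u)) := hu (omegaT T).
rewrite vsval_omegaT -hfo hu formZl formZr => /mulIf.
by rewrite gt_eqF ?pf // => /(_ isT) ->; rewrite conjCK.
Qed.

Lemma weight_orthogonal a b u w : has_weight a u -> has_weight b w ->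
  f u w != 0 -> a = b.
Proof.
move=> hu hw fuw.
have w0 : w != 0 by apply: contraNneq fuw => ->; rewrite form0r.
apply/lfunP => T.
have := hfo (vsval T) u w.
rewrite hu -vsval_omegaT hw formZl formZr (weight_real hw w0) conjCK.
by move/(mulIf fuw).
Qed.

Lemma rootsp_omega z a X : X \in gpart S z -> rootsp a X -> real_weight a ->
  rootsp (- a) (omega S X).
Proof.
move=> hX ha ra T; case: hom => omL _ _ omB.
rewrite -[T]omegaTK vsval_omegaT -omB -[br X _]opprK.
rewrite -(br_even_skew (csa_even _) hX) ha -scaleNr.
rewrite -[X in omega S X]addr0 omL omega0 addr0 rmorphN /= opp_lfunE.
by rewrite omegaTK ra conjCK.
Qed.

(** Both [b] and [b + a] are weights of nonzero vectors, hence real, and so [a] is real. The vector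
    [omega S X] then witnesses the root [- a]. *)
Lemma opp_root z a b X u : X \in gpart S z -> rootsp a X -> a != 0 ->
  has_weight b u -> sact X u != 0 ->
  roots_of z (- a) /\ rootsp (- a) (omega S X).
Proof.
move=> hX ha a0 hu Xu0; case: hom => _ omP omK _.
have u0 : u != 0 by apply: contraNneq Xu0 => ->; rewrite linear0.
have X0 : X != 0 by apply: contraNneq Xu0 => ->; rewrite sact0l.
have ra : real_weight a.
  move=> T; have := weight_real (has_weight_sact hX ha hu) Xu0 T.
  by rewrite !add_lfunE (weight_real hu u0) rmorphD /= => /addrI.
have hr := rootsp_omega hX ha ra; split=> //; split; first by rewrite oppr_eq0.
exists (omega S X); split=> //; last exact: omP.
by apply: contraNneq X0 => /(congr1 (omega S)); rewrite omK omega0 => ->.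
Qed.

(** A letter (z, a, X) is a vector [X] of parity [z] and weight [a], where [a]
    is negative at [H0]; [X] may vanish. *)
Definition letter (l : bool * wt S * S) : Prop :=
  [/\ l.2 \in gpart S l.1.1, rootsp l.1.2 l.2 & (l.1.2 H0 : C) < 0].

Definition word (s : seq (bool * wt S * S)) u : H :=
  foldr (fun l : bool * wt S * S => @sact R S H l.2) u s.

Definition letters (s : seq (bool * wt S * S)) : Prop :=
  forall l, l \in s -> letter l.

Lemma letters_cons l s : letters (l :: s) <-> letter l /\ letters s.
Proof.
split=> [h|[hl hs] l']; last by rewrite inE => /orP[/eqP->|/hs].
by split=> [|l' hl']; apply: h; rewrite inE ?eqxx // hl' orbT.
Qed.

Lemma letters_cat s t : letters (s ++ t) <-> letters s /\ letters t.
Proof.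
split=> [h|[hs ht] l]; last by rewrite mem_cat => /orP[/hs|/ht].
by split=> l hl; apply: h; rewrite mem_cat hl ?orbT.
Qed.

Lemma letter_br l l' : letter l -> letter l' ->
  letter (l.1.1 (+) l'.1.1, l.1.2 + l'.1.2, br l.2 l'.2).
Proof.
case=> h1 h2 h3 [h1' h2' h3']; split=> /=.
- exact: br_parity.
- exact: rootsp_br h1 h1' h2 h2'.
- by rewrite add_lfunE -[X in _ < X]addr0 ltrD.
Qed.

Lemma word_cat s t u : word (s ++ t) u = word s (word t u).
Proof. exact: foldr_cat. Qed.

Lemma word_cons l s u : word (l :: s) u = sact l.2 (word s u).
Proof. by []. Qed.

Lemma wordD s x y : word s (x + y) = word s x + word s y.
Proof. by elim: s => // l s IH; rewrite !word_cons IH linearD. Qed.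

Lemma wordZ s c x : word s (c *: x) = c *: word s x.
Proof. by elim: s => // l s IH; rewrite !word_cons IH linearZ. Qed.

Lemma word0 s : word s 0 = 0.
Proof. by rewrite -(scale0r 0) wordZ !scale0r. Qed.

Lemma word_weight s : letters s ->
  has_weight (Lam + \sum_(l <- s) l.1.2) (word s v).
Proof.
elim: s => [_ T|l s IH /letters_cons[[h1 h2 h3] hs]] /=.
  by rewrite big_nil addr0; case: hwv => _ ->.
by rewrite big_cons [l.1.2 + _]addrC addrA; exact: has_weight_sact h1 h2 (IH hs).
Qed.

Lemma word_hpart s : letters s -> exists z, hpart z (word s v).
Proof.
elim: s => [_|l s IH /letters_cons[[h1 h2 h3] /IH[z hz]]] /=.
  by exists zv.
by exists (l.1.1 (+) z); apply: sact_parity.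
Qed.

(** Encoding the linear span as an intersection of subspaces makes membership itself the induction
    principle. *)
Definition word_span : set H := [set u | forall W : set H, Defs.subspace W ->
  (forall s, letters s -> W (word s v)) -> W u].

Lemma word_span_subspace : Defs.subspace word_span.
Proof.
split=> [W [W0 _] _ //|c x y hx hy W hW hs].
by have [_] := hW; apply; [exact: hx|exact: hy].
Qed.

Lemma word_in_span s : letters s -> word_span (word s v).
Proof. by move=> hs W _; apply. Qed.

Lemma word_span_ind (W : set H) u : word_span u -> Defs.subspace W ->
  (forall s, letters s -> W (word s v)) -> W u.
Proof. exact. Qed.

Lemma sact_preimage (X : S) (W : set H) : Defs.subspace W ->
  Defs.subspace [set u | W (sact X u)].
Proof.
case=> W0 hW; split=> /=; first by rewrite linear0.
by move=> c x y hx hy; rewrite linearP; apply: hW.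
Qed.

Lemma word_span_letter l u : letter l -> word_span u -> word_span (sact l.2 u).
Proof.
move=> hl hu; apply: (word_span_ind hu (sact_preimage l.2 word_span_subspace)).
by move=> s hs /=; apply: (@word_in_span (l :: s)); apply/letters_cons.
Qed.

(** Weight zero puts [X] in the Cartan subalgebra, which acts on a word by a scalar, and a negative
    weight makes [X] a letter; only positive weights need an argument. *)
Lemma word_span_nonpositive s z a X : letters s -> X \in gpart S z ->
  rootsp a X -> (P a -> word_span (sact X (word s v))) ->
  word_span (sact X (word s v)).
Proof.
have [W0 WD WZ] := subspace_closed word_span_subspace.
move=> hs hX ha hpos.
have [->|X0] := eqVneq X 0; first by rewrite sact0l.
have [a0|a0] := eqVneq a 0.
  rewrite a0 in ha; have hXc := zero_rootsp hS hX ha.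
  have := word_weight hs (vsproj (cartan S) X); rewrite vsprojK // => ->.
  by apply: WZ; exact: word_in_span.
have ra : Defs.roots a by case: z hX => hX; [right|left]; split=> //; exists X.
have [ap|an] := hH0 ra; first by apply: hpos; rewrite hP.
by apply: (@word_span_letter (z, a, X)); [split|exact: word_in_span].
Qed.

(** A positive [X] is moved to the right until it kills [v]. Its commutator with a letter may have a
    weight of any sign, so the induction on the word treats all weights at once. *)
Lemma word_span_weight_vector s z a X : letters s -> X \in gpart S z ->
  rootsp a X -> word_span (sact X (word s v)).
Proof.
have [W0 WD WZ] := subspace_closed word_span_subspace.
elim: s z a X => [|l s IH] z a X hs hX ha;
  apply: (word_span_nonpositive hs hX ha) => Pa.
  by case: hwv => _ _ h; rewrite (h a X Pa ha).
have /letters_cons[hl hs'] := hs; have [l1 l2 l3] := hl.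
have := sact_br (word s v) hX l1.
move/(congr1 (fun x => x + (-1) ^+ (z && l.1.1) *: sact l.2 (sact X (word s v)))).
rewrite subrK => <-; apply: WD.
  exact: IH hs' (br_parity hX l1) (rootsp_br hX l1 ha l2).
apply: WZ; apply: word_span_letter hl _.
exact: IH hs' hX ha.
Qed.

Lemma word_span_sact X u : word_span u -> word_span (sact X u).
Proof.
have [W0 WD WZ] := subspace_closed word_span_subspace.
have [X0 [X1 [h0 h1 ->]]] := gpart_decomp X.
have key z Y : Y \in gpart S z -> word_span u -> word_span (sact Y u).
  move=> hY hu; have [l -> hl] := weight_decomp hS hY.
  apply: (word_span_ind hu (sact_preimage _ word_span_subspace)) => s hs /=.
  elim: l hl => [|x l IH] hl; first by rewrite big_nil sact0l.
  rewrite big_cons sactDl; apply: WD; last first.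
    by apply: IH => y hy; apply: hl; rewrite inE hy orbT.
  have [hx [a ha]] := hl x (mem_head _ _).
  exact: word_span_weight_vector hs hx ha.
by move=> hu; rewrite sactDl; apply: WD; [exact: key h0 hu|exact: key h1 hu].
Qed.

(** Simplicity concerns graded submodules, so the span must contain the homogeneous parts of its
    elements; it does because words are homogeneous. *)
Lemma word_span_graded u : word_span u -> exists u0 u1,
  [/\ hpart false u0 /\ word_span u0, hpart true u1 /\ word_span u1
    & u = u0 + u1].
Proof.
have [W0 WD WZ] := subspace_closed word_span_subspace.
move=> hu; pose W := [set x : H | exists x0 x1,
  [/\ hpart false x0 /\ word_span x0, hpart true x1 /\ word_span x1
    & x = x0 + x1]].
apply: (word_span_ind (W := W) hu) => [|s hs].
  split; first by exists 0, 0; rewrite addr0; split=> //; split=> //; apply: hpart0.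
  move=> c x y [x0 [x1 [[? ?] [? ?] ->]]] [y0 [y1 [[? ?] [? ?] ->]]].
  exists (c *: x0 + y0), (c *: x1 + y1).
  have [_ hF] := hpart_sub H false; have [_ hT] := hpart_sub H true.
  split; [by split; [exact: hF|apply: WD => //; apply: WZ]|
    by split; [exact: hT|apply: WD => //; apply: WZ]|].
  by rewrite scalerDr addrACA.
have [[] hz] := word_hpart hs.
  exists 0, (word s v); rewrite add0r; split=> //; split=> //.
  - exact: hpart0.
  - exact: word_in_span.
exists (word s v), 0; rewrite addr0; split=> //; split=> //.
- exact: word_in_span.
- exact: hpart0.
Qed.

Lemma word_spanT u : word_span u.
Proof.
have [|E|->//] := hsimple (W := word_span).
  split; [exact: word_span_subspace|exact: word_span_sact|].
  move=> u0 u1 h0 h1 /word_span_graded[w0 [w1 [[g0 s0] [g1 s1] e]]].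
  have hpartB z x y : hpart z x -> hpart z y -> hpart z (x - y : H).
    move=> hx hy; have [_ hp] := hpart_sub H z.
    by have := hp (-1) y x hy hx; rewrite scaleN1r addrC.
  have e' : u0 - w0 = w1 - u1.
    rewrite -[u0](addrK u1) e [w0 + w1]addrC -!addrA; congr (w1 + _).
    by rewrite addrCA subrr addr0.
  have e0 : u0 - w0 = 0.
    by apply: hpart_cap; [exact: hpartB|rewrite e'; exact: hpartB].
  have e1 : w1 = u1 by apply/eqP; rewrite -subr_eq0 -e' e0.
  by move/eqP: e0; rewrite subr_eq0 => /eqP ->; rewrite -e1.
have : word_span v by apply: (@word_in_span [::]).
by rewrite E /= => v0; case: hwv; rewrite v0 eqxx.
Qed.

(** * Pairing words with an even singular vector *)

Variables (w : H) (gam : wt S).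
Hypothesis hw : has_weight (Lam - gam) w.
Hypothesis hsing : forall a X, pos0 S a -> X \in gpart S false ->
  rootsp a X -> sact X w = 0.

Lemma word_even_head l s : letter l -> l.1.1 = false -> letters s ->
  f (word (l :: s) v) w = 0.
Proof.
move=> [l1 l2 l3] l0 hs; rewrite word_cons.
(* Only a nonzero product guarantees that the weight of the letter is real. *)
have [->|nz] := eqVneq (sact l.2 (word s v)) 0; first exact: form0l.
have a0 : l.1.2 != 0.
  by apply: contraTneq l3 => ->; rewrite zero_lfunE ltxx.
have [r1 r2] := opp_root l1 l2 a0 (word_weight hs) nz.
rewrite l0 in l1 r1; case: hom => _ omP _ _.
rewrite hfo (hsing _ (omP _ _ l1) r2) ?form0r // -hP0; split=> //.
by rewrite hP; split; [left|rewrite opp_lfunE oppr_gt0].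
Qed.

Section Induction.
Variable n : nat.
Hypothesis IHn : forall s, letters s -> (size s < n)%N -> f (word s v) w = 0.

(** The bracket of two letters is again a letter, so the commutator term is a word shorter by one,
    to which the induction hypothesis applies. *)
Lemma word_swap p y l q : letters (p ++ [:: y, l & q]) ->
  size (p ++ [:: y, l & q]) = n ->
  f (word (p ++ [:: l, y & q]) v) w = 0 ->
  f (word (p ++ [:: y, l & q]) v) w = 0.
Proof.
move=> /letters_cat[hp /letters_cons[hy /letters_cons[hl hq]]] sz h.
have [y1 y2 y3] := hy; have [l1 l2 l3] := hl.
have := sact_br (word q v) y1 l1.
move/eqP; rewrite eq_sym subr_eq => /eqP e.
have -> : word (p ++ [:: y, l & q]) v =
    word (p ++ (y.1.1 (+) l.1.1, y.1.2 + l.1.2, br y.2 l.2) :: q) v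
    + (-1) ^+ (y.1.1 && l.1.1) *: word (p ++ [:: l, y & q]) v.
  by rewrite !word_cat !word_cons /= e wordD wordZ.
rewrite formDl formZl h mulr0 addr0; apply: IHn.
  by apply/letters_cat; split=> //; apply/letters_cons; split=> //;
     apply: letter_br.
by rewrite -sz !size_cat /= !addnS.
Qed.

Lemma word_move p s l q : letters (p ++ s ++ l :: q) ->
  size (p ++ s ++ l :: q) = n ->
  f (word (p ++ l :: s ++ q) v) w = 0 ->
  f (word (p ++ s ++ l :: q) v) w = 0.
Proof.
elim: s p => //= y s IHs p hs sz h.
rewrite -cat_rcons; apply: IHs; rewrite ?cat_rcons //.
apply: word_swap => //.
- move: hs => /letters_cat[hp /letters_cons[hy /letters_cat[hs']]].
  move=> /letters_cons[hl hq].
  by apply/letters_cat; split=> //; do 2 (apply/letters_cons; split=> //);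
     apply/letters_cat.
- by rewrite -sz !(size_cat, size_rcons) /= !(size_cat, size_rcons) /= !addnS.
Qed.

(** Odd root spaces being lines, the product of the two letters is a multiple
    of the square of an odd root vector, hence of an even letter. *)
Lemma word_repeat p l l' q : letters (p ++ [:: l, l' & q]) ->
  size (p ++ [:: l, l' & q]) = n -> l.1.1 -> l'.1.1 -> l.1.2 = l'.1.2 ->
  f (word (p ++ [:: l, l' & q]) v) w = 0.
Proof.
move=> /letters_cat[hp /letters_cons[hl /letters_cons[hl' hq]]] sz z z' e.
have [l1 l2 l3] := hl; have [l1' l2' l3'] := hl'.
have [l0|l0] := eqVneq l'.2 0.
  by rewrite word_cat !word_cons l0 sact0l linear0 word0 form0l.
rewrite z e in l1 l2; rewrite z' in l1'.
have [c hc] := odd_rootsp_line hS l1 l1' l2 l2' l0.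
have e2 : sact l'.2 (sact l'.2 (word q v)) =
    (2^-1 : C) *: sact (br l'.2 l'.2) (word q v).
  rewrite (sact_br _ l1' l1') /= expr1 scaleN1r opprK -mulr2n.
  rewrite -[X in _ *: X]scaler_nat.
  by rewrite scalerA mulVf ?pnatr_eq0 // scale1r.
have -> : word (p ++ [:: l, l' & q]) v =
    (c / 2) *: word (p ++ (l'.1.1 (+) l'.1.1, l'.1.2 + l'.1.2, br l'.2 l'.2) :: q) v.
  rewrite !word_cat !word_cons /= hc sactZl e2.
  by rewrite scalerA wordZ.
rewrite formZl IHn ?mulr0 //.
  by apply/letters_cat; split=> //; apply/letters_cons; split=> //;
     apply: letter_br.
by rewrite -sz !size_cat /= !addnS.
Qed.

End Induction.

(** Every suffix of a nonvanishing word is nonvanishing, so each letter acts nontrivially on a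
    weight vector and [opp_root] applies to it. *)
Lemma odd_word_pos1 s : letters s -> (forall l, l \in s -> l.1.1) ->
  word s v != 0 -> forall l, l \in s -> pos1 P (- l.1.2).
Proof.
elim: s => // l s IHs /letters_cons[[l1 l2 l3] hs] ho; rewrite word_cons => nz l'.
rewrite inE => /orP[/eqP ->|]; last first.
  apply: IHs => // [x hx|]; first by apply: ho; rewrite inE hx orbT.
  by apply: contraNneq nz => ->; rewrite linear0.
have a0 : l.1.2 != 0.
  by apply: contraTneq l3 => ->; rewrite zero_lfunE ltxx.
have [r1 _] := opp_root l1 l2 a0 (word_weight hs) nz.
rewrite ho ?mem_head // in r1; split=> //.
by rewrite hP; split; [right|rewrite opp_lfunE oppr_gt0].
Qed.

Lemma not_uniq_map_split (T1 T2 : eqType) (h : T1 -> T2) (s : seq T1) :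
  ~~ uniq (map h s) -> exists s1 s2 s3 x y,
    s = s1 ++ x :: s2 ++ y :: s3 /\ h x = h y.
Proof.
elim: s => //= x s IHs; rewrite negb_and negbK => /orP[/mapP[y]|/IHs].
  by case/splitPr => s2 s3 e; exists [::], s2, s3, x, y.
by case=> [s1 [s2 [s3 [a [b [-> e]]]]]]; exists (x :: s1), s2, s3, a, b.
Qed.

Lemma word_orthogonal s : ~ distinct_sums (pos1 P) gam -> letters s ->
  f (word s v) w = 0.
Proof.
move=> hg; have [n] := ubnP (size s); elim: n s => // n IH s sz hs.
have {}IH s' : letters s' -> (size s' < size s)%N -> f (word s' v) w = 0.
  by move=> h1 h2; apply: IH => //; apply: leq_trans h2 _.
have [/hasP[l ls l0]|/hasPn odd_s] := boolP (has (fun l => ~~ l.1.1) s).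
  case/splitPr: ls sz hs IH => s1 s2 _ hs IH.
  apply: (word_move (p := [::]) IH) => //.
  have /letters_cat[h1 /letters_cons[hl h2]] := hs.
  by apply: word_even_head => //; [exact: negbTE|apply/letters_cat].
have {}odd_s l : l \in s -> l.1.1 by move=> /odd_s; rewrite negbK.
have [uq|] := boolP (uniq [seq l.1.2 | l <- s]).
  apply/eqP; apply: contra_notT hg => nz.
  have nz' : word s v != 0 by apply: contraNneq nz => ->; rewrite form0l.
  have := weight_orthogonal (word_weight hs) hw nz => /addrI e.
  exists [seq - a | a <- [seq l.1.2 | l <- s]].
    rewrite map_inj_uniq ?uq; last exact: oppr_inj.
    split=> // a /mapP[b /mapP[l ls ->] ->].
    exact: odd_word_pos1 ls.
  by rewrite big_map sumrN big_map e opprK.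
case/not_uniq_map_split => s1 [s2 [s3 [l [l' [es e]]]]].
have := es; rewrite -cat_rcons => es'; move: IH; rewrite es' => IH.
apply: (word_move IH) => //; first by rewrite -es'.
rewrite cat_rcons; apply: (word_repeat IH) => //.
- move: hs; rewrite es => /letters_cat[h1 /letters_cons[hl /letters_cat[h2]]].
  move=> /letters_cons[hl' h3].
  by apply/letters_cat; split=> //; do 2 (apply/letters_cons; split=> //);
     apply/letters_cat.
- by rewrite !(size_cat, size_rcons) /= !(size_cat, size_rcons) /= !addnS.
- by apply: odd_s; rewrite es mem_cat mem_head orbT.
- by apply: odd_s; rewrite es !(mem_cat, inE) eqxx !orbT.
Qed.

Lemma singular_weight : w != 0 -> distinct_sums (pos1 P) gam.
Proof.
move=> w0; apply: contrapT => hg.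
have : f w w = 0.
  apply: (word_span_ind (W := [set u | f u w = 0]) (word_spanT w)) => /=.
    split=> /= [|c x y hx hy]; first exact: form0l.
    by rewrite formDl formZl hx hy mulr0 addr0.
  by move=> s hs; apply: word_orthogonal.
by case: hf => _ _ pf; move/eqP; rewrite gt_eqF ?pf.
Qed.

End Words.

(** * Weight decompositions from diagonal coordinates *)

Section Coordinates.
Variables (R : realType) (S : superdatum R).
Local Notation C := (complex R).
Implicit Types (V : {vspace S}) (I : finType) (X Y T : S).

(** Coordinates on [V] in which the Cartan subalgebra acts diagonally. They
    need not be independent. *)
Record weight_coords V I (c lam : I -> S -> C) : Prop := WeightCoords {
  coord_linear : forall i a X Y, X \in V -> Y \in V ->
    c i (a *: X + Y) = a * c i X + c i Y;
  coord_inj : forall X, X \in V -> (forall i, c i X = 0) -> X = 0;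
  coord_diag : forall i T X, T \in cartan S -> X \in V ->
    c i (br T X) = lam i T * c i X
}.

Section OneSpace.
Variables (V : {vspace S}) (I : finType) (c lam : I -> S -> C).
Hypothesis hc : weight_coords V c lam.
Hypothesis hV : forall T X, T \in cartan S -> X \in V -> br T X \in V.

Lemma coord0 i : c i 0 = 0.
Proof.
have := coord_linear hc i 1 (mem0v V) (mem0v V).
by rewrite scale1r addr0 mul1r -[X in X = _]addr0 => /addrI.
Qed.

Lemma coordZ i a X : X \in V -> c i (a *: X) = a * c i X.
Proof.
by move=> hX; have := coord_linear hc i a hX (mem0v V); rewrite coord0 !addr0.
Qed.

Lemma coordB i X Y : X \in V -> Y \in V -> c i (X - Y) = c i X - c i Y.
Proof.
move=> hX hY; have := coord_linear hc i (-1) hY hX.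
by rewrite scaleN1r mulN1r addrC => ->; rewrite addrC.
Qed.

(** As [lam] is not assumed linear, the weight is read off from the coordinate [i0] of the bracket,
    which is linear in [T]. *)
Lemma coord_weight_vector i0 X : X \in V -> c i0 X != 0 ->
  (forall i, c i X != 0 -> forall T, T \in cartan S -> lam i T = lam i0 T) ->
  exists a : wt S, rootsp a X.
Proof.
move=> hX ci0 hlam.
pose fl (T : csa S) : C^o := c i0 (br (vsval T) X) / c i0 X.
have fl_linear : linear fl.
  move=> b T T'; rewrite /fl linearP /= brDl brZl (coord_linear hc) ?hV ?subvsP //.
  by rewrite mulrDl -mulrA.
pose fL := HB.pack_for {linear csa S -> C^o} fl
  (GRing.isLinear.Build _ _ _ _ fl fl_linear).
exists (linfun fL) => T; rewrite lfunE /= /fl; have hT := subvsP T.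
rewrite (coord_diag hc) // mulfK //; apply/eqP; rewrite -subr_eq0; apply/eqP.
apply: (coord_inj hc) => [|i]; first by rewrite rpredB ?rpredZ // hV.
rewrite coordB ?coordZ ?rpredZ ?hV // (coord_diag hc) //.
by have [->|/hlam ->//] := eqVneq (c i X) 0; rewrite ?mulr0 subrr.
Qed.

(** If two weights [lam i T != lam j T] occur in [X] then [ad T - lam i T] and
    [ad T - lam j T] shrink the support of [X], and [X] is a combination of
    the two images. *)
Lemma coord_weight_decomp X : X \in V -> exists2 l : seq S,
  X = \sum_(Y <- l) Y & forall Y, Y \in l -> Y \in V /\ exists a, rootsp a Y.
Proof.
have [n] := ubnP #|[pred i | c i X != 0]|.
elim: n X => // n IH X hn hX.
have [->|X0] := eqVneq X 0; first by exists [::]; rewrite ?big_nil.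
have [i0 ci0] : exists i, c i X != 0.
  apply: contrapT => /forallNP h; case/eqP: X0; apply: (coord_inj hc) => // i.
  by apply/eqP/negPn/negP; apply: h.
have [hall|] := pselect (forall i, c i X != 0 ->
    forall T, T \in cartan S -> lam i T = lam i0 T).
  exists [:: X]; first by rewrite big_seq1.
  move=> Y; rewrite inE => /eqP ->; split=> //.
  exact: coord_weight_vector ci0 hall.
move=> /existsNP[j /not_implyP[cj /existsNP[T /not_implyP[hT /eqP neq]]]].
pose X' i := br T X - lam i T *: X.
have hX' i : X' i \in V by rewrite rpredB ?rpredZ ?hV.
have cX' i i' : c i' (X' i) = (lam i' T - lam i T) * c i' X.
  by rewrite coordB ?coordZ ?rpredZ ?hV // (coord_diag hc) // mulrBl.
have dec i : c i X != 0 -> exists2 l : seq S,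
    X' i = \sum_(Y <- l) Y &
    forall Y, Y \in l -> Y \in V /\ exists a, rootsp a Y.
  move=> ci; apply: IH => //; rewrite -ltnS; apply: leq_trans hn.
  rewrite ltnS; apply/proper_card/properP; split.
    apply/fintype.subsetP => i'; rewrite !inE cX'; apply: contraNneq => ->.
    by rewrite mulr0.
  by exists i; rewrite !inE // cX' subrr mul0r eqxx.
have [l1 e1 h1] := dec _ ci0; have [l2 e2 h2] := dec _ cj.
pose d := lam j T - lam i0 T; have d0 : d != 0 by rewrite subr_eq0.
exists ([seq d^-1 *: Y | Y <- l1] ++ [seq - d^-1 *: Y | Y <- l2]).
  rewrite big_cat !big_map -!scaler_sumr -e1 -e2 /X' /= scaleNr -scalerBr.
  rewrite opprB [_ - _ + _]addrC addrA subrK -scalerBl.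
  by rewrite scalerA mulVf // scale1r.
move=> Y; rewrite mem_cat => /orP[] /mapP[Z hZ ->].
  have [ZV [a ha]] := h1 Z hZ; split; first by rewrite rpredZ.
  by exists a => T'; rewrite linearZ /= ha !scalerA mulrC.
have [ZV [a ha]] := h2 Z hZ; split; first by rewrite rpredZ.
by exists a => T'; rewrite linearZ /= ha !scalerA mulrC.
Qed.

End OneSpace.

(** Since distinct odd coordinates have distinct weights, all vectors of an odd root space are
    supported on one common coordinate, so the space is a line. The condition on weight zero speaks
    of vectors, not of coordinates, because the coordinates may be dependent. *)
Lemma regular_of_coords (I0 I1 : finType) (c0 lam0 : I0 -> S -> C)
    (c1 lam1 : I1 -> S -> C) :
  (forall T, T \in cartan S -> T \in gpart S false) ->
  (forall T, T \in cartan S -> omega S T \in cartan S) ->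
  weight_coords (gpart S false) c0 lam0 ->
  weight_coords (gpart S true) c1 lam1 ->
  (forall X, X \in gpart S false -> (forall i, c0 i X != 0 ->
     forall T, T \in cartan S -> lam0 i T = 0) -> X \in cartan S) ->
  (forall X i, X \in gpart S true -> c1 i X != 0 ->
     exists2 T, T \in cartan S & lam1 i T != 0) ->
  (forall X Y i j, X \in gpart S true -> Y \in gpart S true ->
     c1 i X != 0 -> c1 j Y != 0 -> i != j ->
     exists2 T, T \in cartan S & lam1 i T != lam1 j T) ->
  regular_cartan S.
Proof.
move=> hev hom hc0 hc1 hz hnz hdist.
have stab z T X : T \in cartan S -> X \in gpart S z -> br T X \in gpart S z.
  by move=> /hev hT hX; have := br_parity hT hX.
have lamE V I (c lam : I -> S -> C) a X i (hc : weight_coords V c lam) :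
    X \in V -> rootsp a X -> c i X != 0 ->
    forall T, T \in cartan S -> lam i T = a (vsproj (cartan S) T).
  move=> hX ha ci T hT; have := ha (vsproj (cartan S) T).
  rewrite vsprojK // => /(congr1 (c i)); rewrite (coord_diag hc) //.
  by rewrite (coordZ hc) // => /(mulIf ci).
split=> //.
- by case=> X hX; [apply: (coord_weight_decomp hc1)|apply: (coord_weight_decomp hc0)]
    => // T Y; apply: stab.
- case=> X hX h0; last first.
    apply: hz => // i ci T hT.
    by rewrite (lamE _ _ _ _ _ _ _ hc0 hX h0 ci T hT) zero_lfunE.
  suff -> : X = 0 by exact: mem0v.
  apply: (coord_inj hc1) => // i; apply/eqP/negPn/negP => ci.
  have [T hT] := hnz X i hX ci.
  by rewrite (lamE _ _ _ _ _ _ _ hc1 hX h0 ci T hT) zero_lfunE eqxx.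
- move=> a X Y hX hY haX haY Y0.
  have [j cj] : exists j, c1 j Y != 0.
    apply: contrapT => /forallNP h; case/eqP: Y0; apply: (coord_inj hc1) => // i.
    by apply/eqP/negPn/negP; apply: h.
  have only i Z : Z \in gpart S true -> rootsp a Z -> c1 i Z != 0 -> i = j.
    move=> hZ haZ ci; apply: contrapT => /eqP neq.
    have [T hT] := hdist _ _ _ _ hZ hY ci cj neq.
    rewrite (lamE _ _ _ _ _ _ _ hc1 hZ haZ ci T hT).
    by rewrite (lamE _ _ _ _ _ _ _ hc1 hY haY cj T hT) eqxx.
  exists (c1 j X / c1 j Y); apply/eqP; rewrite -subr_eq0; apply/eqP.
  apply: (coord_inj hc1) => [|i]; first by rewrite rpredB ?rpredZ.
  rewrite (coordB hc1) ?rpredZ // (coordZ hc1) //.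
  have [->|/eqP ij] := eqVneq i j; first by rewrite divfK // subrr.
  have -> : c1 i X = 0 by apply/eqP/negPn/negP => /(only _ _ hX haX).
  have -> : c1 i Y = 0 by apply/eqP/negPn/negP => /(only _ _ hY haY).
  by rewrite mulr0 subrr.
Qed.

End Coordinates.

(** * The families sl(m|n) and gl(n|n) *)

Section TypeA.
Variable R : realType.
Local Notation C := (complex R).

Lemma mxpart_entry m n a (Z : 'M[C]_(m + n)) p q : mxpart a Z -> Z p q != 0 ->
  ((p < m) (+) (q < m))%N = a.
Proof.
rewrite -{2}[Z]submxK => hZ.
case: (split_ordP p) => p' ->; case: (split_ordP q) => q' ->;
  rewrite ?block_mxEul ?block_mxEur ?block_mxEdl ?block_mxEdr /= ?ltn_ord
    ?ltnNge ?leq_addr /=;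
  by case: a hZ => -[e1 e2]; rewrite ?e1 ?e2 ?mxE ?eqxx.
Qed.

Lemma iota_br_even m n (g : lieSuper R) (P : set 'M[C]_(m + n))
    (iota : {linear g -> 'M[C]_(m + n)}) z (T X : g) :
  mx_identification P iota -> T \in gpart g false -> X \in gpart g z ->
  iota (br T X) = iota T *m iota X - iota X *m iota T.
Proof.
by case=> _ _ _ h hT hX; rewrite (h _ _ _ _ hT hX) expr0 scale1r.
Qed.

Lemma invmx_involution n (J : 'M[C]_n) : J *m J = 1%:M -> invmx J = J.
Proof.
by move=> h; rewrite -[invmx J]mulmx1 -h mulKmx //; case: (mulmx1_unit h).
Qed.

(** The weights are differences of diagonal entries and do not see scalar matrices, so it is enough
    that [P] contains every diagonal matrix up to a scalar. This covers sl(m|n) and gl(n|n)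
    together. *)
Lemma typeA_regular m n (P : set 'M[C]_(m + n)) (S : superdatum R) :
  (forall d : 'rV[C]_(m + n), exists a, P (diag_mx d + a%:M)) ->
  typeA_datum P S -> regular_cartan S.
Proof.
move=> hP [iota [hid hcar _ _ [[p [s [_ hom]]] _]]].
have [inj im part _] := hid.
have hev T : T \in cartan S -> T \in gpart S false.
  move=> /hcar /diag_mxP[d hd]; apply/part; rewrite /mxpart /= hd.
  rewrite -[d]hsubmxK diag_mx_row.
  by rewrite block_mxKur block_mxKdl.
have brE z T X i j : T \in cartan S -> X \in gpart S z ->
    iota (br T X) i j = (iota T i i - iota T j j) * iota X i j.
  move=> hT hX; rewrite (iota_br_even hid (hev T hT) hX).
  have /hcar /diag_mxP[d ->] := hT.
  by rewrite mul_diag_mx mul_mx_diag !mxE !eqxx !mulr1n mulrBl [d _ j * _]mulrC.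
have sep i : exists2 T, T \in cartan S & forall j l,
    iota T j j - iota T l l = (j == i)%:R - (l == i)%:R.
  have [a /im[T hT]] := hP (delta_mx 0 i); exists T.
    by apply/hcar; rewrite hT -diag_const_mx -linearD /= diag_mx_is_diag.
  move=> j l; rewrite hT !mxE !eqxx !mulr1n /=.
  by rewrite opprD addrACA subrr addr0.
pose c (x : 'I_(m + n) * 'I_(m + n)) (X : S) := iota X x.1 x.2.
pose lam (x : 'I_(m + n) * 'I_(m + n)) (T : S) :=
  iota T x.1 x.1 - iota T x.2 x.2.
have hc z : weight_coords (gpart S z) c lam.
  split=> [i a X Y _ _|X hX h|i T X hT hX].
  - by rewrite /c linearP !mxE.
  - apply: inj; rewrite linear0; apply/matrixP => i j; rewrite mxE.
    exact: (h (i, j)).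
  - exact: brE hX.
have offd (x : 'I_(m + n) * 'I_(m + n)) (X : S) : X \in gpart S true ->
    c x X != 0 -> x.1 != x.2.
  move=> /part hX /(mxpart_entry hX) h.
  by apply: contraTneq h => ->; rewrite addbb.
apply: (regular_of_coords (I0 := _) (I1 := _) hev _ (hc false) (hc true)).
- move=> T /hcar /diag_mxP[d hd]; apply/hcar; rewrite hom hd.
  set J := block_mx _ _ _ _.
  (* [J] is diagonal with entries of square 1, so it is its own inverse and conjugation by it
     preserves diagonal matrices. *)
  have [e [-> he]] : exists e : 'rV[C]_(m + n), J = diag_mx e /\
      forall i, e 0 i * e 0 i = 1.
    exists (row_mx (\row_(i < m) (-1) ^+ (p <= i)%N) (const_mx ((-1) ^+ s))).
    split; first by rewrite diag_mx_row diag_const_mx.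
    move=> i; case: (split_ordP i) => i' ->;
      by rewrite ?row_mxEl ?row_mxEr !mxE -expr2 sqrr_sign.
  rewrite invmx_involution; last first.
    rewrite mulmx_diag -diag_const_mx; congr diag_mx; apply/rowP => i.
    by rewrite !mxE he.
  apply/is_diag_mxP => i j; rewrite val_eqE => ij.
  rewrite mul_mx_diag mul_diag_mx !mxE [j == i]eq_sym (negbTE ij).
  by rewrite mulr0n conjC0 mulr0 mul0r.
- move=> X hX h; apply/hcar/is_diag_mxP => i j; rewrite val_eqE => ij.
  apply/eqP/negPn/negP => nz; have [T hT e] := sep i.
  have := h (i, j) nz T hT; rewrite /lam /= e eqxx [j == i]eq_sym (negbTE ij).
  by rewrite subr0 => /eqP; rewrite oner_eq0.
- move=> X [i j] hX nz; have /= ij := offd _ _ hX nz.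
  have [T hT e] := sep i; exists T => //.
  by rewrite /lam /= e eqxx [j == i]eq_sym (negbTE ij) subr0 oner_eq0.
- move=> X Y [i j] [i' j'] hX hY nX nY.
  have /= ij := offd _ _ hX nX; have /= ij' := offd _ _ hY nY.
  (* If the first indices agree, the element separating [j] gives the values -1 and 0; otherwise the
     one separating [i] gives 1 against 0 or -1. *)
  have [ii|ii _] := eqVneq i i'.
    rewrite -ii in ij' *; rewrite xpair_eqE eqxx /= => jj.
    have [T hT e] := sep j; exists T => //.
    rewrite /lam /= !e eqxx (negbTE ij) [j' == j]eq_sym (negbTE jj) subrr sub0r.
    by rewrite oppr_eq0 oner_eq0.
  have [T hT e] := sep i; exists T => //.
  rewrite /lam /= !e eqxx [j == i]eq_sym (negbTE ij) [i' == i]eq_sym (negbTE ii).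
  rewrite subr0 sub0r; case: (j' == i); last by rewrite oppr0 oner_eq0.
  by rewrite eq_sym eqNr oner_eq0.
Qed.

(** The supertrace of a scalar matrix is a multiple of m - n, which is nonzero, so adding a scalar
    corrects the supertrace of any diagonal matrix. *)
Lemma sl_regular (S : superdatum R) : sl_datum S -> regular_cartan S.
Proof.
case=> m [n [m0 n0 mn]]; apply: typeA_regular => d.
have tr_scalar (a : C) : supertr (a%:M : 'M[C]_(m + n)) = a * (m%:R - n%:R).
  rewrite /supertr scalar_mx_block block_mxKul block_mxKdr !mxtrace_scalar.
  by rewrite mulrBr !mulr_natr.
have mn0 : (m%:R - n%:R : C) != 0 by rewrite subr_eq0 eqr_nat.
have trD (X Y : 'M[C]_(m + n)) : supertr (X + Y) = supertr X + supertr Y.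
  rewrite -[X]submxK -[Y]submxK add_block_mx /supertr !block_mxKul !block_mxKdr.
  by rewrite !mxtraceD opprD addrACA.
exists (- supertr (diag_mx d) / (m%:R - n%:R)).
by rewrite /slmx /= trD tr_scalar divfK // subrr.
Qed.

Lemma gl_regular (S : superdatum R) : gl_datum S -> regular_cartan S.
Proof. by case=> n [_]; apply: typeA_regular => d; exists 0. Qed.

End TypeA.

(** * The family osp(m|2n) *)

Section PairedMatrices.
Variable R : realType.
Local Notation C := (complex R).

Definition odd_fun n (s : 'I_n -> 'I_n) (tau : 'I_n -> C) :=
  forall i, tau (s i) = - tau i.

(** For odd [tau] this is the common shape of the Cartan elements of so(m) and sp(2n): [s] exchanges
    the two coordinates of each plane, and its fixed points, where [tau] vanishes, are unpaired
    coordinates. *)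
Definition paired_mx n (s : 'I_n -> 'I_n) (tau : 'I_n -> C) : 'M[C]_n :=
  \matrix_(i, j) ('i * tau i * (j == s i)%:R).

(** The rows of [1 + 'i s], with [s] seen as a permutation matrix, are
    eigenvectors of the matrices [paired_mx s tau] for odd [tau]; these are the
    coordinates of [M] with respect to such eigenvectors on both sides. *)
Definition paired_coord m n (s : 'I_m -> 'I_m) (s' : 'I_n -> 'I_n)
    (M : 'M[C]_(m, n)) i j : C :=
  M i j + 'i * M (s i) j + 'i * M i (s' j) - M (s i) (s' j).

Lemma paired_mulmx m n (s : 'I_m -> 'I_m) tau (M : 'M[C]_(m, n)) i j :
  (paired_mx s tau *m M) i j = 'i * tau i * M (s i) j.
Proof.
rewrite mxE (bigD1 (s i)) //= mxE eqxx mulr1 big1 ?addr0 // => k /negbTE ks.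
by rewrite mxE ks mulr0 mul0r.
Qed.

Lemma mulmx_paired m n (s : 'I_n -> 'I_n) tau (M : 'M[C]_(m, n)) i j :
  involutive s -> odd_fun s tau ->
  (M *m paired_mx s tau) i j = - ('i * tau j * M i (s j)).
Proof.
move=> sK ts; rewrite mxE (bigD1 (s j)) //= mxE sK eqxx mulr1 ts big1.
  by ring.
move=> k ks; rewrite mxE; case: eqP => [E|]; last by rewrite !mulr0.
by rewrite E sK eqxx in ks.
Qed.

Lemma paired_coordP m n (s : 'I_m -> 'I_m) (s' : 'I_n -> 'I_n) a
    (M N : 'M[C]_(m, n)) i j :
  paired_coord s s' (a *: M + N) i j =
  a * paired_coord s s' M i j + paired_coord s s' N i j.
Proof. by rewrite /paired_coord !mxE; ring. Qed.

Lemma sqr_i : 'i * 'i = -1 :> C.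
Proof. by rewrite -expr2 sqrCi. Qed.

(** Right multiplication contributes [+ tau' j] because paired matrices are skew, so the weights are
    sums rather than differences. *)
Lemma paired_coord_comm m n (s : 'I_m -> 'I_m) (s' : 'I_n -> 'I_n) tau tau'
    (M : 'M[C]_(m, n)) i j :
  involutive s -> involutive s' -> odd_fun s tau -> odd_fun s' tau' ->
  paired_coord s s' (paired_mx s tau *m M - M *m paired_mx s' tau') i j =
  (tau i + tau' j) * paired_coord s s' M i j.
Proof.
move=> sK sK' ts ts'.
have E i' j' : (paired_mx s tau *m M - M *m paired_mx s' tau') i' j' =
    'i * tau i' * M (s i') j' + 'i * tau' j' * M i' (s' j').
  by rewrite [LHS]mxE [X in _ + X]mxE paired_mulmx mulmx_paired // opprK.
rewrite /paired_coord !E sK sK' ts ts'.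
by ring: sqr_i.
Qed.

(** As [s] squares to 1, the inverse of [1 + 'i s] is half of [1 - 'i s]; inverting on both sides
    produces the factor 4. *)
Lemma paired_coord_inv m n (s : 'I_m -> 'I_m) (s' : 'I_n -> 'I_n)
    (M : 'M[C]_(m, n)) i j : involutive s -> involutive s' ->
  4 * M i j = paired_coord s s' M i j - 'i * paired_coord s s' M (s i) j
    - 'i * paired_coord s s' M i (s' j) - paired_coord s s' M (s i) (s' j).
Proof.
by move=> sK sK'; rewrite /paired_coord !sK !sK'; ring: sqr_i.
Qed.

Lemma four_neq0 : (4 : C) != 0.
Proof. by rewrite pnatr_eq0. Qed.

Lemma paired_coord_eq0 m n (s : 'I_m -> 'I_m) (s' : 'I_n -> 'I_n)
    (M : 'M[C]_(m, n)) : involutive s -> involutive s' ->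
  (forall i j, paired_coord s s' M i j = 0) -> M = 0.
Proof.
move=> sK sK' h; apply/matrixP => i j; apply: (mulfI four_neq0).
by rewrite (paired_coord_inv M i j sK sK') !h mxE !mulr0 !subr0.
Qed.

Lemma paired_mx_ctr n (s : 'I_n -> 'I_n) tau : involutive s -> odd_fun s tau ->
  ctr (paired_mx s tau) = paired_mx s (fun i => Num.conj (tau i)).
Proof.
move=> sK ts; apply/matrixP => i j; rewrite !mxE !rmorphM /= conjCi rmorph_nat.
have [->|/eqP ij] := eqVneq i (s j).
  by rewrite sK eqxx ts rmorphN /=; ring.
have -> : (j == s i) = false.
  by apply/negP => /eqP E; apply: ij; rewrite E sK.
by rewrite !mulr0.
Qed.

Lemma paired_mx_tr n (s : 'I_n -> 'I_n) tau : involutive s -> odd_fun s tau ->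
  (paired_mx s tau)^T = - paired_mx s tau.
Proof.
move=> sK ts; apply/matrixP => i j; rewrite !mxE.
have [->|/eqP ij] := eqVneq i (s j); first by rewrite sK eqxx ts; ring.
have -> : (j == s i) = false.
  by apply/negP => /eqP E; apply: ij; rewrite E sK.
by rewrite !mulr0 oppr0.
Qed.

Lemma paired_mx_mul n (s : 'I_n -> 'I_n) tau tau' : involutive s ->
  odd_fun s tau' ->
  paired_mx s tau *m paired_mx s tau' = diag_mx (\row_i (tau i * tau' i)).
Proof.
move=> sK ts'; apply/matrixP => i j; rewrite paired_mulmx !mxE sK ts'.
rewrite [j == i]eq_sym; case: eqP => _ /=; last by rewrite !mulr0.
by rewrite mulr1 mulr1n; ring: sqr_i.
Qed.

Lemma paired_mx_comm n (s : 'I_n -> 'I_n) tau tau' : involutive s ->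
  odd_fun s tau -> odd_fun s tau' ->
  paired_mx s tau *m paired_mx s tau' = paired_mx s tau' *m paired_mx s tau.
Proof.
move=> sK ts ts'; rewrite !paired_mx_mul //; congr diag_mx.
by apply/rowP => i; rewrite !mxE mulrC.
Qed.

Lemma paired_mx_sqr n (s : 'I_n -> 'I_n) tau : involutive s -> odd_fun s tau ->
  (forall i, tau i * tau i = 1) -> paired_mx s tau *m paired_mx s tau = 1%:M.
Proof.
move=> sK ts t1; rewrite paired_mx_mul // -diag_const_mx; congr diag_mx.
by apply/rowP => i; rewrite !mxE.
Qed.

(** On each plane the matrices with this support are spanned by the identity and the rotation, and
    the zero diagonal excludes the identity. *)
Lemma paired_mx_of_coord n (s : 'I_n -> 'I_n) (M : 'M[C]_n) : involutive s ->
  (forall i j, paired_coord s s M i j != 0 -> j = s i) ->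
  (forall i, M i i = 0) ->
  exists2 tau, odd_fun s tau & M = paired_mx s tau.
Proof.
move=> sK hM Md; exists (fun i => - 'i * M i (s i)).
  move=> i; rewrite sK; have [fi|nfi] := eqVneq (s i) i.
    by rewrite fi Md mulr0 oppr0.
  apply: (mulfI four_neq0).
  have -> : 4 * (- 'i * M (s i) i) = - 'i * (4 * M (s i) i) by ring.
  have -> : 4 * - (- 'i * M i (s i)) = 'i * (4 * M i (s i)) by ring.
  rewrite (paired_coord_inv M (s i) i sK sK) (paired_coord_inv M i (s i) sK sK).
  rewrite !sK.
  have e0 j : s j != j -> paired_coord s s M j j = 0.
    by move=> jj; apply/eqP/negPn/negP => /hM /eqP; rewrite eq_sym (negbTE jj).
  rewrite (e0 i) // (e0 (s i)) ?sK 1?eq_sym //.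
  by ring.
apply/matrixP => i j; rewrite mxE.
have [->|nj] := eqVneq j (s i); first by rewrite mulr1; ring: sqr_i.
rewrite mulr0; have [->|ji] := eqVneq j i; first exact: Md.
apply: (mulfI four_neq0); rewrite (paired_coord_inv M i j sK sK).
have e0 k l : l != s k -> paired_coord s s M k l = 0.
  by move=> kl; apply/eqP/negPn/negP => /hM /eqP; apply/negP.
have sji : s j != i by apply: contraNneq nj => <-; rewrite sK.
by rewrite !e0 ?sK ?(can_eq sK) //; ring.
Qed.

Lemma paired_mx_entry n (s : 'I_n -> 'I_n) tau i :
  - 'i * paired_mx s tau i (s i) = tau i.
Proof. by rewrite mxE eqxx mulr1; ring: sqr_i. Qed.

Lemma odd_fun_conj n (s : 'I_n -> 'I_n) tau : odd_fun s tau ->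
  odd_fun s (fun i => Num.conj (tau i)).
Proof. by move=> ts i; rewrite ts rmorphN. Qed.

(** Odd functions vanish at all fixed points of [s], so there may be at most one. If [i] is not
    fixed, the indicator of [i] minus that of [s i] takes the value 1 at [i] only. *)
Lemma odd_fun_separates n (s : 'I_n -> 'I_n) i j : involutive s ->
  (forall k l, s k = k -> s l = l -> k = l) -> i != j ->
  exists2 tau, odd_fun s tau & tau i != tau j.
Proof.
move=> sK fixs; wlog fi : i j / s i != i.
  move=> wl ij; have [fi|fi] := eqVneq (s i) i; last exact: wl.
  have [fj|fj] := eqVneq (s j) j; first by rewrite (fixs i j) ?eqxx in ij.
  by have [|tau h1 h2] := wl j i fj; [rewrite eq_sym|exists tau; rewrite // eq_sym].
move=> ij; exists (fun k => (k == i)%:R - (k == s i)%:R).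
  by move=> k; rewrite (can_eq sK) opprB -{1}(sK i) (can_eq sK).
rewrite eqxx [i == s i]eq_sym (negbTE fi) [j == i]eq_sym (negbTE ij) subr0 sub0r.
case: (j == s i); last by rewrite oppr0 oner_eq0.
by rewrite eq_sym eqNr oner_eq0.
Qed.

Lemma odd_fun_sum_neq0 n (s : 'I_n -> 'I_n) i j : involutive s ->
  (forall k l, s k = k -> s l = l -> k = l) -> j != s i ->
  exists2 tau, odd_fun s tau & tau i + tau j != 0.
Proof.
move=> sK fixs ji.
have [|tau ts h] := odd_fun_separates (i := s i) (j := j) sK fixs.
  by rewrite eq_sym.
by exists tau => //; move: h; rewrite ts eqr_oppLR addr_eq0.
Qed.

End PairedMatrices.

(** * The Cartan subalgebras of so(m) and sp(2n) as paired matrices *)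

Section Osp.
Variable R : realType.
Local Notation C := (complex R).

(** When [p.+1] is out of range [insubd] returns [p] itself, so the last index is fixed if [m] is
    odd. *)
Definition so_swap m (p : 'I_m) : 'I_m := insubd p (if odd p then p.-1 else p.+1).

Definition so_weight m (t : 'rV[C]_(m./2)) (p : 'I_m) : C :=
  \sum_(k < m./2) t 0 k * ((p == k.*2 :> nat)%:R - (p == k.*2.+1 :> nat)%:R).

Lemma so_swapP m (p : 'I_m) :
  [\/ exists k, p = k.*2 :> nat /\ so_swap p = k.*2.+1 :> nat,
      exists k, p = k.*2.+1 :> nat /\ so_swap p = k.*2 :> nat
    | exists k, [/\ p = k.*2 :> nat, so_swap p = p & m = k.*2.+1]].
Proof.
have := odd_double_half p; have hp := ltn_ord p; rewrite /so_swap.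
case: (odd p) => /= e.
  apply: Or32; exists p./2; split; first by lia.
  by rewrite val_insubd (_ : (p.-1 < m)%N); lia.
have [pm|pm] := ltnP p.+1 m.
  apply: Or31; exists p./2; split; first by lia.
  by rewrite val_insubd pm; lia.
apply: Or33; exists p./2; split; [by lia| |by lia].
by apply/val_inj; rewrite val_insubd ltnNge pm.
Qed.

Lemma so_swapK m : involutive (@so_swap m).
Proof.
move=> p; apply/val_inj => /=.
have [[k [e1 e2]]|[k [e1 e2]]|[k [_ e _]]] := so_swapP p; last by rewrite !e.
  have [[l [e3 e4]]|[l [e3 e4]]|[l [e3 e4 e5]]] := so_swapP (so_swap p); lia.
have [[l [e3 e4]]|[l [e3 e4]]|[l [e3 e4 e5]]] := so_swapP (so_swap p); try lia.
by have := ltn_ord p; lia.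
Qed.

Lemma so_swap_fixed m (p q : 'I_m) : so_swap p = p -> so_swap q = q -> p = q.
Proof.
move=> /(congr1 val) /= hp /(congr1 val) /= hq; apply/val_inj => /=.
have [[k [e1 e2]]|[k [e1 e2]]|[k [e1 _ e2]]] := so_swapP p; try lia.
have [[l [e3 e4]]|[l [e3 e4]]|[l [e3 _ e4]]] := so_swapP q; lia.
Qed.

Lemma so_cartan_paired m (t : 'rV[C]_(m./2)) :
  so_cartan t = paired_mx (@so_swap m) (so_weight t).
Proof.
apply/matrixP => p q; rewrite /so_cartan summxE mxE /so_weight.
rewrite mulr_sumr mulr_suml; apply: eq_bigr => k _; rewrite !mxE.
rewrite mulrCA -!mulrA; congr (_ * (_ * _)); rewrite mulrBl -!natrM !mulnb.
have hk := ltn_ord k; rewrite -[q == _]val_eqE /=.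
congr (_%:R - _%:R); congr (nat_of_bool _);
  have [[l [e1 e2]]|[l [e1 e2]]|[l [e1 /(congr1 val) /= e2 e3]]] := so_swapP p; lia.
Qed.

Lemma so_weight_odd m (t : 'rV[C]_(m./2)) : odd_fun (@so_swap m) (so_weight t).
Proof.
move=> p; rewrite /so_weight -sumrN; apply: eq_bigr => k _.
rewrite -mulrN opprB; have hk := ltn_ord k.
congr (_ * (_%:R - _%:R)); congr (nat_of_bool _);
  have [[l [e1 e2]]|[l [e1 e2]]|[l [e1 /(congr1 val) /= e2 e3]]] := so_swapP p; lia.
Qed.

Lemma so_weight_half m (t : 'rV[C]_(m./2)) (p : 'I_m) (k : 'I_m./2) (b : bool) :
  p = (b + k.*2)%N :> nat -> so_weight t p = t 0 k * (-1) ^+ b.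
Proof.
move=> pk; rewrite /so_weight (bigD1 k) //= big1 ?addr0.
  have -> : (p == k.*2 :> nat) = ~~ b by case: b pk; lia.
  have -> : (p == k.*2.+1 :> nat) = b by case: b pk; lia.
  by case: (b); rewrite /= ?sub0r ?subr0.
move=> l /negbTE; rewrite -val_eqE /= => lk.
have -> : (p == l.*2 :> nat) = false by case: b pk; lia.
have -> : (p == l.*2.+1 :> nat) = false by case: b pk; lia.
by rewrite subrr mulr0.
Qed.

Lemma so_weightE m (tau : 'I_m -> C) : odd_fun (@so_swap m) tau ->
  exists t, tau =1 so_weight t.
Proof.
move=> ts.
have dbl (k : 'I_m./2) : (k.*2 < m)%N.
  by have := odd_double_half m; have := ltn_ord k; lia.
exists (\row_k tau (Ordinal (dbl k))) => p.
have hp := ltn_ord p; have hm := odd_double_half m; have om := leq_b1 (odd m).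
have [[k [e1 e2]]|[k [e1 e2]]|[k [e1 e2 e3]]] := so_swapP p.
- have sp := ltn_ord (so_swap p); have km : (k < m./2)%N by lia.
  rewrite (@so_weight_half _ _ _ (Ordinal km) false) // mxE mulr1; congr tau.
  exact/val_inj.
- have km : (k < m./2)%N by lia.
  rewrite (@so_weight_half _ _ _ (Ordinal km) true) // mxE expr1 mulrN1 -ts.
  congr tau.
  set q := Ordinal _; have eq : q = k.*2 :> nat by [].
  apply/val_inj; change (p = so_swap q :> nat).
  have [[l [e3 e4]]|[l [e3 e4]]|[l [e3 _ e4]]] := so_swapP q; lia.
- rewrite /so_weight big1 => [|l _]; last first.
    have hl := ltn_ord l.
    have -> : (p == l.*2 :> nat) = false by lia.
    have -> : (p == l.*2.+1 :> nat) = false by lia.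
    by rewrite subrr mulr0.
  (* At the unpaired index, a fixed point, oddness forces the value 0. *)
  have := ts p; rewrite e2 => /eqP; rewrite -addr_eq0 -mulr2n mulrn_eq0 /=.
  by move/eqP.
Qed.

Definition sp_swap n (p : 'I_(n + n)) : 'I_(n + n) :=
  match split p with inl a => rshift n a | inr a => lshift n a end.

Lemma sp_swapl n (a : 'I_n) : sp_swap (lshift n a) = rshift n a.
Proof. by rewrite /sp_swap (unsplitK (inl a)). Qed.

Lemma sp_swapr n (a : 'I_n) : sp_swap (rshift n a) = lshift n a.
Proof. by rewrite /sp_swap (unsplitK (inr a)). Qed.

Lemma sp_swapK n : involutive (@sp_swap n).
Proof. by move=> p; case: (split_ordP p) => a ->; rewrite !(sp_swapl, sp_swapr). Qed.

Lemma sp_swap_neq n (p : 'I_(n + n)) : sp_swap p != p.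
Proof.
case: (split_ordP p) => a ->; rewrite ?sp_swapl ?sp_swapr.
  by rewrite eq_rlshift.
by rewrite eq_lrshift.
Qed.

Lemma sp_swap_fixed n (p q : 'I_(n + n)) :
  sp_swap p = p -> sp_swap q = q -> p = q.
Proof. by move/eqP; rewrite (negbTE (sp_swap_neq p)). Qed.

Definition sp_weight n (d : 'rV[C]_n) (p : 'I_(n + n)) : C :=
  match split p with inl a => d 0 a | inr a => - d 0 a end.

Lemma sp_weightl n (d : 'rV[C]_n) a : sp_weight d (lshift n a) = d 0 a.
Proof. by rewrite /sp_weight (unsplitK (inl a)). Qed.

Lemma sp_weightr n (d : 'rV[C]_n) a : sp_weight d (rshift n a) = - d 0 a.
Proof. by rewrite /sp_weight (unsplitK (inr a)). Qed.

Lemma sp_weight_odd n (d : 'rV[C]_n) : odd_fun (@sp_swap n) (sp_weight d).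
Proof.
by move=> p; case: (split_ordP p) => a ->;
   rewrite ?sp_swapl ?sp_swapr ?sp_weightl ?sp_weightr ?opprK.
Qed.

Lemma sp_weightE n (tau : 'I_(n + n) -> C) : odd_fun (@sp_swap n) tau ->
  exists d, tau =1 sp_weight d.
Proof.
move=> ts; exists (\row_a tau (lshift n a)) => p.
case: (split_ordP p) => a ->; rewrite ?sp_weightl ?sp_weightr mxE //.
by rewrite -ts sp_swapl.
Qed.

Lemma sp_cartan_paired n (d : 'rV[C]_n) :
  'i *: (Omega R n *m block_mx (diag_mx d) 0 0 (diag_mx d)) =
  paired_mx (@sp_swap n) (sp_weight d).
Proof.
rewrite /Omega mulmx_block !mul0mx !mulmx0 !add0r !addr0 mulNmx !mul1mx.
apply/matrixP => p q; rewrite mxE [RHS]mxE -mulrA; congr (_ * _).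
case: (split_ordP p) => a ->; case: (split_ordP q) => b ->;
  rewrite ?block_mxEul ?block_mxEur ?block_mxEdl ?block_mxEdr
    ?sp_swapl ?sp_swapr ?sp_weightl ?sp_weightr ?mxE ?eq_lrshift ?eq_rlshift
    ?(inj_eq (@lshift_inj _ _)) ?(inj_eq (@rshift_inj _ _)) ?mulr0 //
    [b == a]eq_sym; by case: eqP => _; rewrite ?mulr1n ?mulr0n ?mulr1 ?mulr0 ?oppr0.
Qed.

Lemma osp_cartanP m n (Z : 'M[C]_(m + (n + n))) :
  (exists t d, Z = osp_cartan t d) <->
  exists tau tau', [/\ odd_fun (@so_swap m) tau, odd_fun (@sp_swap n) tau'
    & Z = block_mx (paired_mx (@so_swap m) tau) 0 0 (paired_mx (@sp_swap n) tau')].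
Proof.
split=> [[t [d ->]]|[tau [tau' [/so_weightE[t ht] /sp_weightE[d hd] ->]]]].
  exists (so_weight t), (sp_weight d); split.
  - exact: so_weight_odd.
  - exact: sp_weight_odd.
  - by rewrite /osp_cartan so_cartan_paired sp_cartan_paired.
exists t, d; rewrite /osp_cartan so_cartan_paired sp_cartan_paired.
by rewrite (funext ht) (funext hd).
Qed.

End Osp.

(** * Regularity of osp(m|2n) *)

Section OspRegular.
Variable R : realType.
Local Notation C := (complex R).

(** The nonscalar block of [J] is thus a Cartan element with all coordinates 1 and commutes with the
    Cartan subalgebra; [so_J_paired] serves the same purpose. *)
Lemma Omega_paired n :
  'i *: Omega R n = paired_mx (@sp_swap n) (sp_weight (const_mx 1)).
Proof.
by rewrite -sp_cartan_paired diag_const_mx -scalar_mx_block mulmx1.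
Qed.

Lemma Omega_paired_sqr n (W := paired_mx (@sp_swap n) (sp_weight (const_mx 1))) :
  W *m W = 1%:M :> 'M[C]_(n + n).
Proof.
apply: paired_mx_sqr; [exact: sp_swapK|exact: sp_weight_odd|move=> i].
by case: (split_ordP i) => a ->; rewrite ?sp_weightl ?sp_weightr !mxE;
   rewrite ?mulrNN mulr1.
Qed.

Lemma so_J_paired m : 'i *: \sum_(i < m./2) Defs.rot R m i =
  paired_mx (@so_swap m) (so_weight (const_mx 1)).
Proof.
rewrite -so_cartan_paired /so_cartan scaler_sumr.
by apply: eq_bigr => i _; rewrite mxE scale1r.
Qed.

Lemma so_J_sqr m (W := paired_mx (@so_swap m) (so_weight (const_mx 1))) :
  ~~ odd m -> W *m W = 1%:M :> 'M[C]_m.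
Proof.
move=> em; apply: paired_mx_sqr; [exact: so_swapK|exact: so_weight_odd|move=> p].
have := odd_double_half p; have := odd_double_half m; have hp := ltn_ord p.
rewrite (negbTE em) add0n => e1 e2; have ob := leq_b1 (odd p).
have km : (p./2 < m./2)%N by lia.
rewrite (@so_weight_half _ _ _ _ (Ordinal km) (odd p)) ?e2 // mxE mul1r.
by rewrite -expr2 sqrr_sign.
Qed.

Lemma paired_osp m n (tau : 'I_m -> C) (tau' : 'I_(n + n) -> C) :
  odd_fun (@so_swap m) tau -> odd_fun (@sp_swap n) tau' ->
  ospmx (block_mx (paired_mx (@so_swap m) tau) 0 0 (paired_mx (@sp_swap n) tau')).
Proof.
move=> ts ts'; split; rewrite ?block_mxKul ?block_mxKdr ?block_mxKdl ?block_mxKur.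
- by rewrite paired_mx_tr ?opprK //; exact: so_swapK.
- rewrite paired_mx_tr //; last exact: sp_swapK.
  have -> : Omega R n = - 'i *: ('i *: Omega R n).
    by rewrite scalerA mulNr sqr_i opprK scale1r.
  rewrite Omega_paired mulmxN mulNmx -!scalemxAl -scalemxAr.
  rewrite (paired_mx_comm (@sp_swapK n) (sp_weight_odd _) ts') -mulmxA.
  by rewrite Omega_paired_sqr mulmx1 scalerA mulrNN sqr_i scaleN1r opprK.
- by rewrite trmx0 mulmx0 oppr0.
Qed.

Lemma block_conj_fixed m n (J1 A : 'M[C]_m) (J2 D : 'M[C]_n) :
  J1 *m J1 = 1%:M -> J2 *m J2 = 1%:M -> A *m J1 = J1 *m A -> D *m J2 = J2 *m D ->
  invmx (block_mx J1 0 0 J2) *m block_mx A 0 0 D *m block_mx J1 0 0 J2 =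
  block_mx A 0 0 D.
Proof.
move=> h1 h2 c1 c2; rewrite invmx_involution; last first.
  by rewrite mulmx_block !mul0mx !mulmx0 !addr0 add0r h1 h2 -scalar_mx_block.
rewrite !mulmx_block !(mul0mx, mulmx0, addr0, add0r).
by rewrite -!mulmxA c1 c2 !mulmxA h1 h2 !mul1mx.
Qed.

Lemma ctr_block m n (A : 'M[C]_m) (D : 'M[C]_n) :
  ctr (block_mx A 0 0 D) = block_mx (ctr A) 0 0 (ctr D).
Proof. by rewrite /ctr tr_block_mx map_block_mx !trmx0 !map_mx0. Qed.

(** Conjugate transposition only conjugates the coordinates. The blocks of [J] square to 1 and are
    scalars or Cartan elements, so conjugation by [J] fixes the result. *)
Lemma osp_omega_cartan m n (g : lieSuper R)
    (iota : {linear g -> 'M[C]_(m + (n + n))}) (om : g -> g) X :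
  osp_omega iota om ->
  (exists t d, iota X = osp_cartan t d) ->
  exists t d, iota (om X) = osp_cartan t d.
Proof.
move=> hom /osp_cartanP[tau [tau' [ts ts' hX]]]; apply/osp_cartanP.
exists (fun i => Num.conj (tau i)), (fun i => Num.conj (tau' i)).
have cs := odd_fun_conj ts; have cs' := odd_fun_conj ts'.
have e : ctr (iota X) = block_mx
    (paired_mx (@so_swap m) (fun i => Num.conj (tau i))) 0 0
    (paired_mx (@sp_swap n) (fun i => Num.conj (tau' i))).
  by rewrite hX ctr_block !paired_mx_ctr //; [exact: sp_swapK|exact: so_swapK].
have sign_sqr q (b : bool) : ((-1) ^+ b)%:M *m ((-1) ^+ b)%:M = 1%:M :> 'M[C]_q.
  by rewrite -scalar_mxM -expr2 sqrr_sign.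
split=> //; case: hom => b [hom|[em hom]];
  rewrite hom e ?Omega_paired ?so_J_paired;
  apply: block_conj_fixed.
- exact: sign_sqr.
- exact: Omega_paired_sqr.
- exact: scalar_mxC.
- by apply: paired_mx_comm => //; [exact: sp_swapK|exact: sp_weight_odd].
- exact: so_J_sqr.
- exact: sign_sqr.
- by apply: paired_mx_comm => //; [exact: so_swapK|exact: so_weight_odd].
- exact: scalar_mxC.
Qed.

Lemma block_mx_comm m n (A : 'M[C]_m) (D : 'M[C]_n) (Z : 'M[C]_(m + n)) :
  block_mx A 0 0 D *m Z - Z *m block_mx A 0 0 D =
  block_mx (A *m ulsubmx Z - ulsubmx Z *m A) (A *m ursubmx Z - ursubmx Z *m D)
    (D *m dlsubmx Z - dlsubmx Z *m A) (D *m drsubmx Z - drsubmx Z *m D).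
Proof.
rewrite -{1 2}[Z]submxK !mulmx_block !(mul0mx, mulmx0, addr0, add0r).
by rewrite opp_block_mx add_block_mx.
Qed.

Lemma Omega_conj n (Z : 'M[C]_(n + n)) : Omega R n *m Z *m Omega R n =
  block_mx (- drsubmx Z) (dlsubmx Z) (ursubmx Z) (- ulsubmx Z).
Proof.
rewrite -{1}[Z]submxK /Omega mulmx_block !mul0mx !mulNmx !mul1mx !add0r !addr0.
by rewrite mulmx_block !mulmx0 !mulmxN !mulmx1 !add0r !addr0 !opprK.
Qed.

Lemma osp_regular (S : superdatum R) : osp_datum S -> regular_cartan S.
Proof.
case=> m [n [_ _ [iota [hid hcar0 _ _ [hom _]]]]].
have [inj im part _] := hid.
pose s1 := @so_swap m; pose s2 := @sp_swap n.
have s1K : involutive s1 by exact: so_swapK.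
have s2K : involutive s2 by exact: sp_swapK.
have hcar X : X \in cartan S <-> exists tau tau', [/\ odd_fun s1 tau,
    odd_fun s2 tau' & iota X = block_mx (paired_mx s1 tau) 0 0 (paired_mx s2 tau')].
  by rewrite hcar0; exact: osp_cartanP.
pose t1 (T : S) p := - 'i * ulsubmx (iota T) p (s1 p).
pose t2 (T : S) p := - 'i * drsubmx (iota T) p (s2 p).
have carE T : T \in cartan S -> [/\ odd_fun s1 (t1 T), odd_fun s2 (t2 T)
    & iota T = block_mx (paired_mx s1 (t1 T)) 0 0 (paired_mx s2 (t2 T))].
  case/hcar => tau [tau' [ts ts' e]].
  have e1 : t1 T = tau.
    by apply/funext => p; rewrite /t1 e block_mxKul paired_mx_entry.
  have e2 : t2 T = tau'.
    by apply/funext => p; rewrite /t2 e block_mxKdr paired_mx_entry.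
  by rewrite e1 e2.
have get_car tau tau' : odd_fun s1 tau -> odd_fun s2 tau' ->
    exists2 T, T \in cartan S & t1 T = tau /\ t2 T = tau'.
  move=> ts ts'.
  have [t [d e]] : exists t d, block_mx (paired_mx s1 tau) 0 0 (paired_mx s2 tau') =
      osp_cartan t d by apply/osp_cartanP; exists tau, tau'.
  have [T hT] : exists T : S, iota T = osp_cartan t d.
    by apply/im; rewrite -e; exact: paired_osp.
  exists T; first by apply/hcar0; exists t, d.
  split; apply/funext => p; rewrite /t1 /t2 hT -e ?block_mxKul ?block_mxKdr;
    exact: paired_mx_entry.
have hev T : T \in cartan S -> T \in gpart S false.
  by move=> /carE[_ _ e]; apply/part; rewrite /mxpart /= e block_mxKur block_mxKdl.
have brE z T X : T \in cartan S -> X \in gpart S z ->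
    [/\ ulsubmx (iota (br T X)) = paired_mx s1 (t1 T) *m ulsubmx (iota X)
          - ulsubmx (iota X) *m paired_mx s1 (t1 T),
        ursubmx (iota (br T X)) = paired_mx s1 (t1 T) *m ursubmx (iota X)
          - ursubmx (iota X) *m paired_mx s2 (t2 T)
      & drsubmx (iota (br T X)) = paired_mx s2 (t2 T) *m drsubmx (iota X)
          - drsubmx (iota X) *m paired_mx s2 (t2 T)].
  move=> hT hX; rewrite (iota_br_even hid (hev T hT) hX).
  have [_ _ ->] := carE T hT; rewrite block_mx_comm.
  by rewrite !(block_mxKul, block_mxKur, block_mxKdr).
pose c0 x (X : S) := match x with
  | inl p => paired_coord s1 s1 (ulsubmx (iota X)) p.1 p.2
  | inr p => paired_coord s2 s2 (drsubmx (iota X)) p.1 p.2 end.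
pose lam0 x T := match x with
  | inl p => t1 T p.1 + t1 T p.2 | inr p => t2 T p.1 + t2 T p.2 end.
pose c1 p (X : S) := paired_coord s1 s2 (ursubmx (iota X)) p.1 p.2.
pose lam1 p T := t1 T p.1 + t2 T p.2.
have ulP a (X Y : S) : ulsubmx (iota (a *: X + Y)) =
    a *: ulsubmx (iota X) + ulsubmx (iota Y).
  by apply/matrixP => i j; rewrite linearP !mxE.
have urP a (X Y : S) : ursubmx (iota (a *: X + Y)) =
    a *: ursubmx (iota X) + ursubmx (iota Y).
  by apply/matrixP => i j; rewrite linearP !mxE.
have drP a (X Y : S) : drsubmx (iota (a *: X + Y)) =
    a *: drsubmx (iota X) + drsubmx (iota Y).
  by apply/matrixP => i j; rewrite linearP !mxE.
have hc0 : weight_coords (gpart S false) c0 lam0.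
  split=> [[p|p] a X Y _ _|X hX h|[p|p] T X hT hX].
  - by rewrite /c0 ulP paired_coordP.
  - by rewrite /c0 drP paired_coordP.
  - apply: inj; rewrite linear0 -[iota X]submxK.
    have [-> ->] : mxpart false (iota X) by apply/part.
    rewrite (paired_coord_eq0 s1K s1K (M := ulsubmx _)) => [|i j].
      rewrite (paired_coord_eq0 s2K s2K (M := drsubmx _)) => [|i j].
        by rewrite block_mx0.
      exact: (h (inr (i, j))).
    exact: (h (inl (i, j))).
  - have [h1 h2 _] := carE T hT; have [e _ _] := brE _ _ _ hT hX.
    by rewrite /c0 e paired_coord_comm.
  - have [h1 h2 _] := carE T hT; have [_ _ e] := brE _ _ _ hT hX.
    by rewrite /c0 e paired_coord_comm.
have hc1 : weight_coords (gpart S true) c1 lam1.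
  split=> [p a X Y _ _|X hX h|p T X hT hX].
  - by rewrite /c1 urP paired_coordP.
  - apply: inj; rewrite linear0 -[iota X]submxK.
    have [-> ->] : mxpart true (iota X) by apply/part.
    (* The lower left block is determined by the upper right one, whose coordinates therefore
       suffice on the odd part. *)
    have [_ _ ->] : ospmx (iota X) by apply/im; exists X.
    rewrite (paired_coord_eq0 s1K s2K (M := ursubmx _)) => [|i j].
      by rewrite trmx0 mulmx0 oppr0 block_mx0.
    exact: (h (i, j)).
  - have [h1 h2 _] := carE T hT; have [_ e _] := brE _ _ _ hT hX.
    by rewrite /c1 e paired_coord_comm.
have fix1 := @so_swap_fixed m; have fix2 := @sp_swap_fixed n.
have zero1 : odd_fun s1 (fun=> 0 : C) by move=> ?; rewrite oppr0.
have zero2 : odd_fun s2 (fun=> 0 : C) by move=> ?; rewrite oppr0.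
apply: (regular_of_coords hev _ hc0 hc1).
- by move=> T /hcar0 hT; apply/hcar0; exact: (osp_omega_cartan hom).
- move=> X hX h; apply/hcar.
  have [hA hD hCC] : ospmx (iota X) by apply/im; exists X.
  have [tau ts eA] : exists2 tau, odd_fun s1 tau &
      ulsubmx (iota X) = paired_mx s1 tau.
    apply: paired_mx_of_coord => // [i j nz|i].
      apply: contrapT => /eqP ij.
      have [tau ts t0] := odd_fun_sum_neq0 R s1K fix1 ij.
      have [T hT [e1 e2]] := get_car _ _ ts zero2.
      by have := h (inl (i, j)) nz T hT; rewrite /lam0 /= e1 => /eqP; apply/negP.
    have /matrixP/(_ i i)/eqP := hA; rewrite !mxE -addr_eq0 -mulr2n.
    by rewrite mulrn_eq0 => /eqP.
  have hcD i j : paired_coord s2 s2 (drsubmx (iota X)) i j != 0 -> j = s2 i.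
    move=> nz; apply: contrapT => /eqP ij.
    have [tau' ts' t0] := odd_fun_sum_neq0 R s2K fix2 ij.
    have [T hT [e1 e2]] := get_car _ _ zero1 ts'.
    by have := h (inr (i, j)) nz T hT; rewrite /lam0 /= e2 => /eqP; apply/negP.
  have [tau' ts' eD] : exists2 tau', odd_fun s2 tau' &
      drsubmx (iota X) = paired_mx s2 tau'.
    apply: paired_mx_of_coord => // i; set D := drsubmx _ in hD hcD *.
    (* The symplectic condition makes the two diagonal entries of a plane opposite, while the
       vanishing coordinates at [(j, j)] make them equal. *)
    have e1 : D (s2 i) (s2 i) = - D i i.
      rewrite {1}hD Omega_conj /s2; case: (split_ordP i) => a ->;
        rewrite ?sp_swapl ?sp_swapr;
        by rewrite ?block_mxEul ?block_mxEdr !mxE.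
    have e0 j : paired_coord s2 s2 D j j = 0.
      apply/eqP/negPn/negP => /hcD /eqP.
      by rewrite eq_sym (negbTE (sp_swap_neq j)).
    have e2 : D (s2 i) (s2 i) = D i i.
      apply: (mulfI (four_neq0 R)).
      rewrite (paired_coord_inv D i i s2K s2K).
      rewrite (paired_coord_inv D (s2 i) (s2 i) s2K s2K).
      by rewrite !s2K !e0; ring.
    by move/eqP: e1; rewrite e2 -addr_eq0 -mulr2n mulrn_eq0 => /eqP.
  exists tau, tau'; split=> //.
  rewrite -[LHS]submxK eA eD.
  by have [-> ->] : mxpart false (iota X) by apply/part.
(* The orthogonal part of an odd weight vanishes at an unpaired index; the symplectic part never
   does, as [s2] has no fixed point. *)
- move=> X [i j] hX _; have [|tau' ts' t0] := @odd_fun_sum_neq0 R _ s2 j j s2K fix2.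
    by rewrite eq_sym sp_swap_neq.
  have [T hT [e1 e2]] := get_car _ _ zero1 ts'; exists T => //.
  rewrite /lam1 /= e1 e2 add0r; apply: contraNneq t0 => ->; rewrite addr0 //.
- move=> X Y [i j] [i' j'] hX hY _ _.
  have [-> /=|ii _] := eqVneq i i'.
    rewrite xpair_eqE eqxx /= => jj.
    have [tau' ts' t0] := odd_fun_separates R s2K fix2 jj.
    have [T hT [e1 e2]] := get_car _ _ zero1 ts'; exists T => //.
    by rewrite /lam1 /= e1 e2 !add0r.
  have [tau ts t0] := odd_fun_separates R s1K fix1 ii.
  have [T hT [e1 e2]] := get_car _ _ ts zero2; exists T => //.
  by rewrite /lam1 /= e1 e2 !addr0.
Qed.
End OspRegular.

(** * The superalgebra F(4) *)

Section Spinors.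
Variable R : realType.
Local Notation C := (complex R).

(** An involution is annihilated by (X - 1)(X + 1), which has distinct roots. *)
Lemma codiagonalizable_involutions n (As : seq 'M[C]_n.+1) :
  {in As &, forall A B, comm_mx A B} -> {in As, forall A, A *m A = 1%:M} ->
  exists2 U : 'M[C]_n.+1, U \in unitmx &
    forall A, A \in As -> exists d, U *m A = diag_mx d *m U.
Proof.
move=> hcomm hsq.
have [|U Uu /allP hU] := (codiagonalizableP As).1.
  split=> // A hA; apply/diagonalizableP; exists [:: 1; -1].
    by rewrite /= inE andbT eq_sym eqNr oner_eq0.
  rewrite big_cons big_seq1; apply: mxminpoly_min.
  rewrite rmorphM !raddfB /= !horner_mx_X !horner_mx_C raddfN opprK /= -mulmxE.
  by rewrite mulmxBl !mulmxDr !mul1mx !mulmx1 hsq // [1%:M + A]addrC subrr.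
exists U => // A hA; have /diagonalizable_forPex[d /(simmxP Uu) e] := hU A hA.
by exists d.
Qed.

(** Conjugation by [a] preserves the trace and negates [M]. *)
Lemma anticomm_mxtrace n (a M : 'M[C]_n) : a *m a = 1%:M ->
  a *m M = - (M *m a) -> \tr M = 0.
Proof.
move=> aa h; have : \tr M = - \tr M.
  rewrite -{1}[M]mulmx1 -aa mulmxA mxtrace_mulC mulmxA h mulNmx -mulmxA aa.
  by rewrite mulmx1 raddfN.
by move/eqP; rewrite -addr_eq0 -mulr2n mulrn_eq0 => /eqP.
Qed.

Variable gam : 'I_7 -> 'M[C]_8.
Hypothesis hgam : clifford7 gam.

Lemma gamK i : gam i *m gam i = 1%:M.
Proof.
have := hgam i i; rewrite eqxx -mulr2n -scaler_nat => /(congr1 ( *:%R (2^-1 : C))).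
rewrite scalerA mulVf ?pnatr_eq0 // scale1r => ->.
by rewrite scale_scalar_mx mulVf ?pnatr_eq0.
Qed.

Lemma gamC i j : i != j -> gam i *m gam j = - (gam j *m gam i).
Proof.
move=> /negbTE ij; have := hgam i j; rewrite ij mul0rn raddf0.
by move/eqP; rewrite addr_eq0 => /eqP.
Qed.

Lemma fst_idx_lt (k : 'I_3) : (k.*2 < 7)%N. Proof. by case: k => -[|[|[|]]]. Qed.
Lemma snd_idx_lt (k : 'I_3) : (k.*2.+1 < 7)%N. Proof. by case: k => -[|[|[|]]]. Qed.

Definition gam1 k := gam (Ordinal (fst_idx_lt k)).
Definition gam2 k := gam (Ordinal (snd_idx_lt k)).
(** The k-th basis element of the Cartan subalgebra of so(7) acts on spinors by half of this
    involution, so its eigenvalues are twice the k-th coordinates of the spin weights. *)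
Definition spin_sign k : 'M[C]_8 := 'i *: (gam1 k *m gam2 k).

Lemma gam1_spin_sign k : gam1 k *m spin_sign k = - (spin_sign k *m gam1 k).
Proof.
rewrite /spin_sign -scalemxAr -scalemxAl -scalerN; congr (_ *: _).
rewrite -[RHS]mulmxN -mulmxA; congr (_ *m _); rewrite mulmxN /gam1 /gam2 -gamC //.
by rewrite -val_eqE /=; lia.
Qed.

Lemma gam_spin_sign (i : 'I_7) (k : 'I_3) :
  i != k.*2 :> nat -> i != k.*2.+1 :> nat ->
  gam i *m spin_sign k = spin_sign k *m gam i.
Proof.
move=> h1 h2; rewrite /spin_sign -scalemxAr -scalemxAl; congr (_ *: _).
by rewrite /gam1 /gam2 mulmxA [gam i *m gam _]gamC // mulNmx
  -[_ *m gam i *m _]mulmxA  [gam i *m _]gamC // mulmxN opprK mulmxA.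
Qed.

Lemma gam1_spin_sign_comm k l : k != l ->
  gam1 k *m spin_sign l = spin_sign l *m gam1 k.
Proof.
rewrite -val_eqE => /= kl; apply: gam_spin_sign => /=; lia.
Qed.

Lemma spin_sign_comm k l : comm_mx (spin_sign k) (spin_sign l).
Proof.
have [->|] := eqVneq k l; first by [].
rewrite -val_eqE => /= kl.
have h1 : gam1 k *m spin_sign l = spin_sign l *m gam1 k.
  by apply: gam_spin_sign => /=; lia.
have h2 : gam2 k *m spin_sign l = spin_sign l *m gam2 k.
  by apply: gam_spin_sign => /=; lia.
move: (spin_sign l) h1 h2 => M h1 h2; rewrite /comm_mx /spin_sign.
by rewrite -scalemxAl -scalemxAr -mulmxA h2 !mulmxA h1.
Qed.

Lemma spin_sign_sqr k : spin_sign k *m spin_sign k = 1%:M.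
Proof.
rewrite {1}/spin_sign -scalemxAl {1}/spin_sign -scalemxAr scalerA sqr_i scaleN1r.
rewrite -mulmxA [gam2 k *m _]mulmxA [gam2 k *m gam1 k]gamC; last first.
  by rewrite -val_eqE /=; lia.
rewrite mulNmx mulmxN opprK -mulmxA [gam2 k *m gam2 k]gamK mulmx1.
exact: gamK.
Qed.

Lemma spin_so_cartan (t : 'rV[C]_3) : spin gam (so_cartan (m := 7) t) =
  2^-1 *: \sum_k t 0 k *: spin_sign k.
Proof.
pose sp (A : 'M[C]_7) := \sum_i \sum_j A i j *: (gam i *m gam j).
have spD A B : sp (A + B) = sp A + sp B.
  rewrite /sp -big_split; apply: eq_bigr => i _; rewrite -big_split.
  by apply: eq_bigr => j _; rewrite mxE scalerDl.
have spZ c A : sp (c *: A) = c *: sp A.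
  rewrite /sp scaler_sumr; apply: eq_bigr => i _; rewrite scaler_sumr.
  by apply: eq_bigr => j _; rewrite mxE scalerA.
have sp_delta a b : sp (delta_mx a b) = gam a *m gam b.
  rewrite /sp (bigD1 a) //= (bigD1 b) //= mxE !eqxx scale1r !big1 ?addr0 //.
    by move=> i /negbTE ia; rewrite big1 // => j _; rewrite mxE ia scale0r.
  by move=> j /negbTE jb; rewrite mxE jb andbF scale0r.
have sp0 : sp 0 = 0 by rewrite -(scale0r 0) spZ scale0r.
rewrite /spin -/(sp _) /so_cartan (big_morph sp spD sp0) !scaler_sumr.
apply: eq_bigr => k _; rewrite !spZ !scalerA.
have -> : Defs.rot R 7 k = delta_mx (Ordinal (fst_idx_lt k)) (Ordinal (snd_idx_lt k))
    + (-1) *: delta_mx (Ordinal (snd_idx_lt k)) (Ordinal (fst_idx_lt k)).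
  by apply/matrixP => i j; rewrite !mxE -!val_eqE /= mulN1r.
rewrite spD spZ !sp_delta -/(gam1 k) -/(gam2 k) scaleN1r.
have -> : gam2 k *m gam1 k = - (gam1 k *m gam2 k).
  by rewrite /gam1 /gam2 gamC // -val_eqE /=; lia.
(* The two opposite entries of the rotation contribute equally, turning 1/4 into 1/2. *)
rewrite opprK -mulr2n -[X in _ *: X]scaler_nat /spin_sign !scalerA.
congr (_ *: _); have h4 : 4^-1 * 2 = 2^-1 :> C.
  by apply: (mulfI (four_neq0 R)); field.
by rewrite -h4; ring.
Qed.

(** The spin weights are simple by a trace count. For the signs [a k] of the eigenvector [i], the
    product of the three matrices [1 + a k * spin_sign k] has trace 8. In the eigenbasis this trace
    is a sum of nonnegative terms, equal to 8 at each eigenvector with the same signs as [i], so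
    there is only one. *)
Lemma spin_codiagonalizable : exists (U : 'M[C]_8) (sg : 'I_3 -> 'rV[C]_8),
  [/\ U \in unitmx, forall k, U *m spin_sign k = diag_mx (sg k) *m U
    & forall i j, i != j -> exists k, sg k 0 i != sg k 0 j].
Proof.
have [|A /mapP[k _ ->]|U Uu hU] := @codiagonalizable_involutions _
    [seq spin_sign k | k <- enum 'I_3].
- by move=> A B /mapP[k _ ->] /mapP[l _ ->]; apply: spin_sign_comm.
- exact: spin_sign_sqr.
have /choice[sg hsg] k : exists d, U *m spin_sign k = diag_mx d *m U.
  by apply: hU; rewrite map_f ?mem_enum.
exists U, sg; split=> // i j ij; apply: contrapT => /forallNP same.
have {}same k : sg k 0 i = sg k 0 j by apply/eqP/negPn/negP; apply: same.
have sg1 k l : sg k 0 l * sg k 0 l = 1.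
  have : diag_mx (sg k) *m diag_mx (sg k) *m U = 1%:M *m U.
    by rewrite -mulmxA -hsg mulmxA -hsg -mulmxA spin_sign_sqr mulmx1 mul1mx.
  move/(congr1 (mulmx^~ (invmx U))); rewrite !mulmxK // mulmx_diag => /matrixP.
  by move=> /(_ l l); rewrite !mxE eqxx !mulr1n.
(* For [a] equal to 1 or -1 this is twice the projector onto the eigenspace of [spin_sign k] for
   [a]. *)
pose F k (a : C) : 'M[C]_8 := 1%:M + a *: spin_sign k.
have step k a (Q : 'M[C]_8) : gam1 k *m Q = Q *m gam1 k ->
    \tr (F k a *m Q) = \tr Q.
  move=> hQ; rewrite mulmxDl mul1mx mxtraceD -scalemxAl mxtraceZ.
  rewrite (anticomm_mxtrace (gamK _) (M := spin_sign k *m Q) (a := gam1 k)).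
    by rewrite mulr0 addr0.
  by rewrite mulmxA gam1_spin_sign mulNmx -[_ *m gam1 k *m Q]mulmxA hQ mulmxA.
have commF k l a : k != l -> gam1 k *m F l a = F l a *m gam1 k.
  move=> kl; rewrite mulmxDl mulmxDr mul1mx mulmx1 -scalemxAl -scalemxAr.
  by rewrite gam1_spin_sign_comm.
have commFQ k l b (Q : 'M[C]_8) : k != l -> gam1 k *m Q = Q *m gam1 k ->
    gam1 k *m (F l b *m Q) = F l b *m Q *m gam1 k.
  by move=> kl hQ; rewrite mulmxA commF // -[_ *m gam1 k *m Q]mulmxA hQ mulmxA.
pose k0 : 'I_3 := inord 0; pose k1 : 'I_3 := inord 1; pose k2 : 'I_3 := inord 2.
have k01 : k0 != k1 by rewrite -val_eqE /= !inordK.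
have k02 : k0 != k2 by rewrite -val_eqE /= !inordK.
have k12 : k1 != k2 by rewrite -val_eqE /= !inordK.
pose a k := sg k 0 i.
have trP : \tr (F k0 (a k0) *m (F k1 (a k1) *m (F k2 (a k2) *m 1%:M))) = 8%:R.
  have c1 k : gam1 k *m 1%:M = 1%:M *m gam1 k by rewrite mul1mx mulmx1.
  rewrite (step k0); last by do 2?apply: (commFQ).
  rewrite (step k1); last exact: commFQ.
  by rewrite (step k2) // mxtrace1.
pose G k := \row_l (1 + a k * sg k 0 l).
have UF k : U *m F k (a k) = diag_mx (G k) *m U.
  have -> : diag_mx (G k) = 1%:M + a k *: diag_mx (sg k).
    apply/matrixP => p q; rewrite !mxE.
    by case: eqP => [->|_]; rewrite ?mulr1n // !mulr0n mulr0 addr0.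
  by rewrite mulmxDr mulmxDl mulmx1 mul1mx -scalemxAr -scalemxAl hsg.
have trE : \tr (F k0 (a k0) *m (F k1 (a k1) *m (F k2 (a k2) *m 1%:M))) =
    \sum_l G k0 0 l * (G k1 0 l * G k2 0 l).
  set M := F k0 _ *m _.
  have MU : U *m M = diag_mx (\row_l (G k0 0 l * (G k1 0 l * G k2 0 l))) *m U.
    have UFQ k Q : U *m (F k (a k) *m Q) = diag_mx (G k) *m (U *m Q).
      by rewrite mulmxA UF mulmxA.
    rewrite /M !UFQ [U *m 1%:M]mulmx1 !mulmxA !mulmx_diag.
    congr (diag_mx _ *m U).
    by apply/rowP => l; rewrite [LHS]mxE [X in X * _]mxE [RHS]mxE mulrA.
  rewrite -[M]mul1mx -(mulVmx Uu) -mulmxA MU mxtrace_mulC mulmxK // mxtrace_diag.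
  by apply: eq_bigr => l _; rewrite mxE.
have sgn k l : sg k 0 l = 1 \/ sg k 0 l = -1.
  have /eqP := sg1 k l; rewrite -expr2 sqrf_eq1 => /orP[] /eqP ->; by [left|right].
have G0 k l : 0 <= G k 0 l.
  rewrite mxE /a; case: (sgn k i) => ->; case: (sgn k l) => ->;
    by rewrite ?mul1r ?mulN1r ?opprK ?subrr // addr_ge0 // ler01.
have G2 k l : sg k 0 l = sg k 0 i -> G k 0 l = 2.
  by move=> e; rewrite mxE e sg1.
have : (8%:R : C) < \sum_l G k0 0 l * (G k1 0 l * G k2 0 l).
  rewrite (bigD1 i) //= (bigD1 j) 1?eq_sym //= addrA !G2 -?same //.
  rewrite ltr_wpDr //; first by apply: sumr_ge0 => l _; rewrite !mulr_ge0.
  by rewrite -!natrM -natrD ltr_nat.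
by rewrite -trE trP ltxx.
Qed.

End Spinors.

(** * Regularity of F(4) *)

Section F4Regular.
Variable R : realType.
Local Notation C := (complex R).

Lemma F4_even_lin c (x y : 'M[C]_7 * 'M[C]_2) : F4_even x -> F4_even y ->
  F4_even (c *: x + y).
Proof.
case=> x1 x2 [y1 y2]; split=> /=.
  by rewrite {1}x1 {1}y1 linearP scalerN -opprD.
by rewrite linearP /= x2 y2 mulr0 addr0.
Qed.

Lemma F4_even_pair_br (x y : 'M[C]_7 * 'M[C]_2) : F4_even x -> F4_even y ->
  F4_even (pair_br x y).
Proof.
case=> x1 x2 [y1 y2]; split=> /=.
  rewrite [in RHS]linearB /= !trmx_mul opprB {1 2}x1 {1 2}y1.
  by rewrite !mulNmx !mulmxN !opprK.
by rewrite linearB /= mxtrace_mulC subrr.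
Qed.

(** The map [phi] is bijective only from [F4_even] onto the even part, so its inverse is chosen
    pointwise and is linear only there. *)
Lemma linear_bij_inverse (V W : lmodType C) (D : set V) (E : set W)
    (f : {linear V -> W}) :
  (forall c x y, D x -> D y -> D (c *: x + y)) -> functions.set_bij D E f ->
  exists g : W -> V, [/\ forall X, E X -> D (g X) /\ f (g X) = X,
    forall x, D x -> g (f x) = x
    & forall c X Y, E X -> E Y -> g (c *: X + Y) = c *: g X + g Y].
Proof.
move=> linD [fD finj fsurj].
pose g X := xget 0 [set x | D x /\ f x = X].
have gP X : E X -> D (g X) /\ f (g X) = X.
  move=> /fsurj[x Dx fx].
  by apply: (@xgetPex _ 0 [set x | D x /\ f x = X]); exists x.
have finj' x y : D x -> D y -> f x = f y -> x = y.
  by move=> hx hy; apply: finj; rewrite inE.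
exists g; split=> // [x Dx|c X Y EX EY].
  by have [h1 h2] := gP _ (fD _ Dx); apply: finj'.
have [DX fX] := gP _ EX; have [DY fY] := gP _ EY; have DXY := linD c _ _ DX DY.
have EXY : E (c *: X + Y) by rewrite -fX -fY -linearP; apply: fD.
have [h1 h2] := gP _ EXY; apply: finj' => //.
by rewrite h2 linearP fX fY.
Qed.

Lemma F4_cartan_even (t : 'rV[C]_3) (d : 'rV[C]_1) : F4_even (F4_cartan t d).
Proof.
split=> /=.
  rewrite so_cartan_paired paired_mx_tr ?opprK //; first exact: so_swapK.
  exact: so_weight_odd.
rewrite mxtrace_diag !big_ord_recl big_ord0 !mxE /= expr0 expr1.
by rewrite mul1r mulN1r addr0 subrr.
Qed.

Lemma F4_regular (S : superdatum R) :
  anti_involution (omega S) -> F4_datum S -> regular_cartan S.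
Proof.
move=> [omL _ _ _] [gam [phi [psi [hid hcar _ _ [[_ hk] _]]]]].
have [[_ hgam] bphi bpsi brphi brpsi] := hid.
have [phiI [phiIP phiK phiIL]] := linear_bij_inverse F4_even_lin bphi.
have [psiI [psiIP psiK psiIL]] := linear_bij_inverse (fun _ _ _ _ _ => I) bpsi.
have carE T : T \in cartan S ->
    exists t d, phiI T = F4_cartan t d /\ T = phi (F4_cartan t d).
  by move=> /hcar[t [d ->]]; exists t, d; rewrite phiK //; exact: F4_cartan_even.
have get_car t d : exists2 T, T \in cartan S & phiI T = F4_cartan t d.
  exists (phi (F4_cartan t d)); first by apply/hcar; exists t, d.
  by rewrite phiK //; exact: F4_cartan_even.
have phi_even x : F4_even x -> phi x \in gpart S false.
  by case: bphi => h _ _; apply: h.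
have psi_odd Z : psi Z \in gpart S true by case: bpsi => h _ _; apply: h.
have hev T : T \in cartan S -> T \in gpart S false.
  by move=> /carE[t [d [_ ->]]]; apply/phi_even/F4_cartan_even.
have br0 T X : T \in cartan S -> X \in gpart S false ->
    phiI (br T X) = pair_br (phiI T) (phiI X).
  move=> /carE[t [d [e ->]]] hX; have [h1 h2] := phiIP X hX.
  have hT := F4_cartan_even t d.
  by rewrite -{1}h2 -brphi // !phiK //; exact: F4_even_pair_br.
have br1 T X : T \in cartan S -> X \in gpart S true ->
    psiI (br T X) = spin gam (phiI T).1 *m psiI X + psiI X *m (phiI T).2^T.
  move=> /carE[t [d [e ->]]] hX; have [_ h2] := psiIP X hX.
  have hT := F4_cartan_even t d.
  by rewrite -{1}h2 brpsi // psiK // phiK.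
have [U [sg [Uu hU sgP]]] := spin_codiagonalizable hgam.
pose s := @so_swap 7; have sK : involutive s by exact: so_swapK.
have fixs := @so_swap_fixed 7.
pose t1 (T : S) p := - 'i * (phiI T).1 p (s p).
pose d1 (T : S) (b : 'I_2) := (phiI T).2 b b.
pose w1 (T : S) j := (U *m spin gam (phiI T).1 *m invmx U) j j.
have t1E T t d : phiI T = F4_cartan t d -> t1 T = so_weight (m := 7) t.
  move=> e; apply/funext => p; rewrite /t1 e /= so_cartan_paired.
  exact: paired_mx_entry.
have d1E T t d : phiI T = F4_cartan t d ->
    (phiI T).2 = diag_mx (\row_b d1 T b) /\
    forall b, d1 T b = (-1) ^+ b * (d 0 0 / 2).
  move=> e; have h b : d1 T b = (-1) ^+ b * (d 0 0 / 2).
    by rewrite /d1 e !mxE eqxx mulr1n.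
  split=> //; rewrite e /=; congr diag_mx; apply/rowP => b; by rewrite !mxE h.
have w1E T t d : phiI T = F4_cartan t d ->
    U *m spin gam (phiI T).1 = diag_mx (\row_j w1 T j) *m U /\
    forall j, w1 T j = 2^-1 * \sum_k t 0 k * sg k 0 j.
  move=> e; pose D : 'rV[C]_8 := 2^-1 *: \sum_k t 0 k *: sg k.
  have eD : U *m spin gam (phiI T).1 = diag_mx D *m U.
    have -> : diag_mx D = 2^-1 *: \sum_k t 0 k *: diag_mx (sg k).
      rewrite /D linearZ /=; congr (_ *: _); rewrite linear_sum /=.
      by apply: eq_bigr => k _; rewrite linearZ.
    rewrite e /= spin_so_cartan // -scalemxAr mulmx_sumr -scalemxAl mulmx_suml.
    congr (_ *: _); apply: eq_bigr => k _.
    by rewrite -scalemxAr -scalemxAl hU.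
  have h j : w1 T j = D 0 j by rewrite /w1 eD mulmxK // !mxE eqxx mulr1n.
  split=> [|j].
    by rewrite eD; congr (diag_mx _ *m U); apply/rowP => j; rewrite [RHS]mxE h.
  rewrite h !mxE summxE; congr (_ * _).
  by apply: eq_bigr => k _; rewrite mxE.
pose c0 x (X : S) := match x with
  | inl p => paired_coord s s (phiI X).1 p.1 p.2
  | inr p => (phiI X).2 p.1 p.2 end.
pose lam0 x T := match x with
  | inl p => t1 T p.1 + t1 T p.2 | inr p => d1 T p.1 - d1 T p.2 end.
(* Only the spinor factor has to be diagonalized; the Cartan elements of sl(2) are already
   diagonal. *)
pose c1 (p : 'I_8 * 'I_2) (X : S) := (U *m psiI X) p.1 p.2.
pose lam1 (p : 'I_8 * 'I_2) T := w1 T p.1 + d1 T p.2.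
have hc0 : weight_coords (gpart S false) c0 lam0.
  split=> [[p|p] a X Y hX hY|X hX h|[p|p] T X hT hX].
  - by rewrite /c0 phiIL //= paired_coordP.
  - by rewrite /c0 phiIL //= !mxE.
  - have [_ <-] := phiIP X hX; rewrite -[RHS](linear0 phi); congr (phi _).
    rewrite [phiI X]surjective_pairing; congr (_, _).
      by apply: (paired_coord_eq0 sK sK) => i j; exact: (h (inl (i, j))).
    by apply/matrixP => i j; rewrite mxE; exact: (h (inr (i, j))).
  - have [t [d [e _]]] := carE T hT; rewrite /c0 br0 //= (t1E _ _ _ e) e /=.
    rewrite so_cartan_paired paired_coord_comm //; exact: so_weight_odd.
  - have [t [d [e _]]] := carE T hT; have [e1 _] := d1E _ _ _ e.
    rewrite /c0 br0 //= e1 mul_diag_mx mul_mx_diag !mxE.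
    by rewrite mulrBl [_ * d1 T p.2]mulrC.
have hc1 : weight_coords (gpart S true) c1 lam1.
  split=> [p a X Y hX hY|X hX h|p T X hT hX].
  - by rewrite /c1 psiIL // mulmxDr -scalemxAr !mxE.
  - have Z0 : U *m psiI X = 0.
      by apply/matrixP => i j; rewrite [RHS]mxE; exact: (h (i, j)).
    have [_ <-] := psiIP X hX; rewrite -[psiI X](mulKmx Uu) Z0 mulmx0.
    exact: linear0.
  - have [t [d [e _]]] := carE T hT.
    have [e1 _] := d1E _ _ _ e; have [e2 _] := w1E _ _ _ e.
    rewrite /c1 br1 // mulmxDr mulmxA e2 e1 tr_diag_mx mulmxA mul_mx_diag.
    rewrite -mulmxA mul_diag_mx !mxE /lam1 mulrDl.
    by rewrite [d1 T _ * _]mulrC.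
have half_neq0 : (2^-1 : C) != 0 by rewrite invr_eq0 pnatr_eq0.
have d1_neq T t b b' : phiI T = F4_cartan t (const_mx 1) -> b != b' ->
    d1 T b != d1 T b'.
  move=> e; have [_ h] := d1E _ _ _ e; rewrite !h mxE mul1r (inj_eq (mulIf half_neq0)).
  have ne1 : (1 : C) != -1 by rewrite eq_sym eqNr oner_eq0.
  case: b b' => -[|[|//]] hb [[|[|//]] hb'] //; rewrite -val_eqE //= !expr0 !expr1 //.
  by rewrite eq_sym.
apply: (regular_of_coords hev _ hc0 hc1).
(* [omega] is -1 on [k], and the Cartan subalgebra is the complexification of its part in [k]. *)
- move=> T hT; have [k [[[_ kg0 _] _] hkE]] := hk.
  have : [set X | X \in cartan S] T by [].
  rewrite hkE => -[Y [Z [[hY kY] [hZ kZ] ->]]].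
  have [_ eY] := kg0 _ kY; have [_ eZ] := kg0 _ kZ.
  by rewrite addrC omL eY eZ rpredD ?rpredZ ?rpredN.
- move=> X hX h; have [[skX trX] eX] := phiIP X hX; apply/hcar.
  have [tau ts eA] : exists2 tau, odd_fun s tau & (phiI X).1 = paired_mx s tau.
    apply: paired_mx_of_coord => // [i j nz|i].
      apply: contrapT => /eqP ij.
      have [tau ts t0] := odd_fun_sum_neq0 R sK fixs ij.
      have [t ht] := so_weightE ts.
      have [T hT e] := get_car t 0.
      have := h (inl (i, j)) nz T hT; rewrite /lam0 /= (t1E _ _ _ e) -!ht => /eqP.
      exact/negP.
    have /matrixP/(_ i i)/eqP := skX; rewrite !mxE -addr_eq0 -mulr2n.
    by rewrite mulrn_eq0 => /eqP.
  have [t ht] := so_weightE ts.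
  (* The factor 2 undoes the halving of [d] in [F4_cartan]. *)
  exists t, (const_mx (2 * (phiI X).2 0 0)); rewrite -{1}eX; congr (phi _).
  rewrite [phiI X]surjective_pairing /F4_cartan so_cartan_paired; congr (_, _).
    by rewrite eA (funext ht).
  have offd i j : i != j -> (phiI X).2 i j = 0.
    move=> ij; apply/eqP/negPn/negP => nz.
    have [T hT e] := get_car 0 (const_mx 1).
    have := h (inr (i, j)) nz T hT; rewrite /lam0 /= => /eqP.
    by rewrite subr_eq0; apply/negP; exact: d1_neq e ij.
  have tr2 : (phiI X).2 1 1 = - (phiI X).2 0 0.
    move: trX; rewrite /mxtrace !big_ord_recl big_ord0 addr0 => /eqP.
    rewrite addrC addr_eq0 => /eqP; congr (_ = _); congr (_ _ _); exact/val_inj.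
  apply/matrixP => i j; rewrite !mxE; have [->|ij] := eqVneq i j; last first.
    by rewrite offd.
  rewrite mulr1n mulrAC mulfV ?pnatr_eq0 // mul1r.
  case: j {i} => -[|[|//]] hj.
    by rewrite expr0 mul1r; congr (_ _ _); exact/val_inj.
  by rewrite expr1 mulN1r -tr2; congr (_ _ _); exact/val_inj.
- move=> X [j b] hX _; have [T hT e] := get_car 0 (const_mx 1).
  exists T => //; rewrite /lam1 /=.
  have [_ ->] := w1E _ _ _ e; have [_ ->] := d1E _ _ _ e.
  rewrite big1 ?mulr0 ?add0r => [|k _]; last by rewrite mxE mul0r.
  by rewrite mxE mul1r mulf_neq0 // signr_eq0.
- move=> X Y [j b] [j' b'] hX hY _ _; have [-> /=|jj _] := eqVneq j j'.
    rewrite xpair_eqE eqxx /= => bb.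
    have [T hT e] := get_car 0 (const_mx 1).
    by exists T => //; rewrite /lam1 /= (inj_eq (addrI _)); exact: d1_neq e bb.
  (* Taking the k-th unit vector for [t] and 0 for [d] isolates a sign that differs at [j] and
     [j']. *)
  have [k hk'] := sgP _ _ jj; have [T hT e] := get_car (delta_mx 0 k) 0.
  exists T => //; rewrite /lam1 /=.
  have [_ hw] := w1E _ _ _ e; have [_ hd] := d1E _ _ _ e.
  rewrite !hd mxE mul0r !mulr0 !addr0 !hw (inj_eq (mulfI half_neq0)).
  have sumE l : \sum_i (delta_mx 0 k : 'rV[C]_3) 0 i * sg i 0 l = sg k 0 l.
    rewrite (bigD1 k) //= mxE !eqxx mul1r big1 ?addr0 // => i /negbTE ik.
    by rewrite mxE ik mul0r.
  by rewrite !sumE.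
Qed.

End F4Regular.

(** * The branching theorem *)

Lemma standard_regular (R : realType) (S : superdatum R) :
  standard S -> regular_cartan S.
Proof.
case=> hom [|[|[|]]]; [exact: sl_regular|exact: gl_regular|exact: osp_regular|].
exact: F4_regular.
Qed.


(** The empty family always contributes 0, so a nonzero supremum requires a nonempty family, any
    member of which is a copy. *)
Lemma mult_neq0 (R : realType) (S : superdatum R) (M : evenrep S) (mu : wt S) :
  mult M mu <> 0%E -> exists W : set M, is_L0 W mu.
Proof.
move=> m0; apply: contrapT => hW; apply: m0; rewrite /mult.
set A := [set _ | _ in _]; suff -> : A = [set 0%E] by rewrite ereal_sup1.
rewrite predeqE => x; split=> [[[|k] [W [hk _]] <-] //|->].
  by case: hW; exists (W ord0).
by exists 0%N => //; exists (fun _ => set0); split=> [[]|u _ _ []].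
Qed.

Theorem lemma52 (R : realType) (S : superdatum R) (P : set (wt S))
    (e : complex R) (k : set S) (Lam : wt S) (H : superrep S)
    (hS : standard S)
    (hP : positive_system P)
    (he : adapted P e)
    (hk : maximal_compact (even_real_form (omega S)) k)
    (hkc : [set X | X \in cartan S] `<=` complexification k)
    (hH : is_simple_hw P H Lam)
    (hU : unitary H) :
  (forall gam, GamL P k e Lam gam ->
     mult (even_restr H) (Lam - gam) <> 0%E ->
     exists2 eta, distinct_sums (pos1 P) eta & cone (pos0 S) (eta - gam))
  /\
  (forall N, is_max_ht P N ->
     forall gam, GamL P k e Lam gam ->
       mult (even_restr H) (Lam - gam) <> 0%E ->
       (ht P gam <= N)%N).
Proof.
have hreg := standard_regular hS; have [hom _] := hS.
have [[H0 [hH0 hPH0]] hP0] := hP.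
have [[zv [v [hv hwv]]] hsimple] := hH; have [f [hf _ hfo]] := hU.
have key gam : mult (even_restr H) (Lam - gam) <> 0%E ->
    distinct_sums (pos1 P) gam.
  case/mult_neq0 => W [_ _ [w [_ w0 hw hsing]]].
  apply: (singular_weight hreg hom hH0 hPH0 hP0 hv hwv hsimple hf hfo _ _ w0).
    by move=> T; apply/hw/cartan_even/subvsP.
  exact: hsing.
split=> [gam _ /key hg|N [_ hN] gam _ /key /hN //].
by exists gam => //; rewrite subrr; exists [::]; rewrite ?big_nil.
Qed.
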